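(* For every Schur function $\phi$ such that the composition operator $C_\phi$ is bounded on $\mathcal{D}_\ast$, and for every $\xi \in \partial\mathbb{D}$, the logarithmic capacity of the set $$E_\phi(\xi) = \{ e^{it} \,;\ \phi(e^{it}) = \xi \}$$ is $0$.
   Context: $\mathbb{D}$ is the open unit disk of $\mathbb{C}$, $\mathbb{T} = \partial\mathbb{D}$, and $A$ is the normalized area measure $dx\,dy/\pi$ on $\mathbb{D}$. A Schur function is an analytic map $\phi\colon\mathbb{D}\to\mathbb{D}$; its composition operator is $C_\phi(f) = f\circ\phi$. The Dirichlet space $\mathcal{D}_\ast$ is the Hilbert space of analytic functions $f\colon \mathbb{D}\to\mathbb{C}$ with $f(0)=0$ and $\|f\|^2 = \int_{\mathbb{D}} |f'|^2\,dA < \infty$. Saying that $C_\phi$ is bounded on $\mathcal{D}_\ast$ means that it maps $\mathcal{D}_\ast$ into itself and is a bounded operator there (in particular $\phi(0)=0$ and $\phi\in\mathcal{D}_\ast$). On the circle, $\phi(e^{it})$ denotes the radial limit $\lim_{r\to1^-}\phi(re^{it})$, and $E_\phi(\xi)$ consists of the points where this limit exists and equals $\xi$. Logarithmic capacity: for a Borel probability measure $\mu$ with compact support in $\mathbb{T}$, its energy is $I_\mu = \iint \log\frac{e}{|z-w|}\,d\mu(w)\,d\mu(z) \in (-\infty,+\infty]$; for a Borel set $E\subseteq\mathbb{T}$, $\mathrm{Cap}\,E = \sup_\mu e^{-I_\mu}$, the supremum being over all Borel probability measures $\mu$ with compact support contained in $E$. Thus $\mathrm{Cap}\,E=0$ iff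 $I_\mu=\infty$ for every such $\mu$. *)

(* Defs.v *)
From HB Require Import structures.
From mathcomp Require Import all_boot all_order all_algebra.
From mathcomp Require Import complex.
From mathcomp Require Import all_classical all_reals all_analysis.
Set Implicit Arguments.
Unset Strict Implicit.
Unset Printing Implicit Defensive.

Import Order.TTheory GRing.Theory Num.Theory.
Import numFieldNormedType.Exports.

Local Open Scope classical_set_scope.
Local Open Scope complex_scope.
Local Open Scope ring_scope.

(* The complex numbers as a normed module over the field R[i]: derivable f z 1
   is complex differentiability at z and derive1 f z the complex derivative.
   The norm `|z| takes its values in R[i]; Normc.normc z is the modulus in R. *)
Notation Cplx R := (R[i]^o).

Section DirichletSpace.
Variable R : realType.
Implicit Types (f phi : Cplx R -> Cplx R) (z w xi : Cplx R).

Definition unit_disk : set (Cplx R) := [set z | `|z| < 1].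

Definition unit_circle : set (Cplx R) := [set z | `|z| = 1].

(* A function on the disk is represented by a total function, whose values off
   the disk play no role. *)
Definition analytic_on_disk f := forall z, unit_disk z -> derivable f z 1.

Definition schur phi :=
  analytic_on_disk phi /\ (forall z, unit_disk z -> unit_disk (phi z)).

(* The integral of |f'|^2 against the area measure dx dy / pi. *)
Definition dirichlet_integral f : \bar R :=
  ((pi^-1)%:E *
   \int[lebesgue_measure \x lebesgue_measure]_(p in
       [set p : R * R | unit_disk (p.1 +i* p.2)])
     (Normc.normc (derive1 f (p.1 +i* p.2)) ^+ 2)%:E)%E.

Definition dirichlet_space : set (Cplx R -> Cplx R) :=
  [set f | [/\ analytic_on_disk f, f 0 = 0 & (dirichlet_integral f < +oo)%E]].

Definition dirichlet_norm f : R := Num.sqrt (fine (dirichlet_integral f)).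

Definition composition_operator phi f : Cplx R -> Cplx R := f \o phi.

Definition bounded_on_dirichlet (T : (Cplx R -> Cplx R) -> Cplx R -> Cplx R) :=
  (forall f, dirichlet_space f -> dirichlet_space (T f)) /\
  (exists M : R, forall f, dirichlet_space f ->
     dirichlet_norm (T f) <= M * dirichlet_norm f).

Definition radial_limit phi z xi :=
  phi (r%:C * z) @[r --> (1 : R)^'-] --> xi.

Definition contact_set phi xi : set (Cplx R) :=
  [set z | unit_circle z /\ radial_limit phi z xi].

End DirichletSpace.

Section LogarithmicCapacity.
Variable R : realType.

Definition borelC := g_sigma_algebraType (@open (Cplx R)).

Implicit Types mu : probability borelC R.

Definition measure_support mu : set (Cplx R) :=
  [set z | forall U : set (Cplx R), open U -> U z -> (0 < mu U)%E].

(* log (e / |z - w|), with value +oo on the diagonal. *)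
Definition log_kernel (z w : Cplx R) : \bar R :=
  if z == w then +oo%E else (ln (expR 1 / Normc.normc (z - w)))%:E.

Definition log_energy mu : \bar R :=
  (\int[mu]_z \int[mu]_w log_kernel z w)%E.

(* The element 0 only serves to give capacity 0, rather than -oo, to a set that
   supports no measure, such as the empty set. *)
Definition log_capacity (E : set (Cplx R)) : \bar R :=
  ereal_sup (0%E |` [set expeR (- log_energy mu)%E | mu in
    [set mu | compact (measure_support mu) /\ measure_support mu `<=` E]]).

End LogarithmicCapacity.

(* Main.v *)
Require Import Defs.
From mathcomp Require Import all_boot all_order all_algebra.
From mathcomp Require Import complex.
From mathcomp Require Import all_classical all_reals all_analysis.
From HB Require Import structures.
From mathcomp Require Import measurable_realfun.
From mathcomp Require Import ring lra.

(* Let C_k(t) be the union of the segments joining a point of the square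
   [-1/2, 1/2]^2 to the point w = r_k t of the disk, with r_k -> 1.  If g is
   holomorphic, averaging the mean value inequality along these segments and
   changing variables gives
     Re g(w) <= max_{square} Re g + 2 \int |g'(p)| K(w, p) dp,
   where K(w, p) is the integral of s^-2 over those s in ]0, 1] for which p lies
   in the square of side s centred at (1 - s) w.  For a probability measure m on
   the circle, Tonelli's theorem bounds the square integral of the potential
   \int K(r_k t, .) dm(t) by a constant plus a multiple of the logarithmic energy
   of m, because two squares of sides s and s' around (1 - s) w and (1 - s') w'
   only meet if |w - w'| <= 3 max(s, s').  Hence \int Re g(r_k t) dm(t) is
   controlled by the Dirichlet norm of g and by the energy of m, uniformly in k.

   This is applied to g = f_N o phi, f_N(z) = \sum_{k <= N} (conj xi z)^k / k.
   Since |f_N'(z)| <= min(N, 2 / |z - xi|), the squared Dirichlet norm of f_N, and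
   so that of g, is O(log N), whereas Re g(r_k t) tends to
   f_N(xi) = 1 + 1/2 + ... + 1/N for every t in the contact set.  If m had finite
   energy, log N would be O(sqrt (log N)).

   The mean value inequality is proved for functions that are merely
   differentiable everywhere, so that no continuity of g', hence no Cauchy theory,
   is needed. *)

Set Implicit Arguments.
Unset Strict Implicit.
Unset Printing Implicit Defensive.
Import Order.TTheory GRing.Theory Num.Theory.
Import numFieldNormedType.Exports.
Local Open Scope classical_set_scope.
Local Open Scope ring_scope.

(** * Mean value inequality for everywhere differentiable functions *)

Section mean_value.
Context {R : realType}.
Local Notation mu := (@lebesgue_measure R).
Let I : set R := `[0, 1]%classic.

(** An approximation in the spirit of Vitali and Caratheodory. The function [psi] is sliced into
    level sets [E n] of height [e]; each is enclosed in an open set [U n] of slightly larger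
    measure, and the height [n.+2%:R * e] is added on the excess of [U n] over [E n]. Points of [I]
    near a point of [E n] lie in [U n], where one of the two contributions suffices. *)
Lemma lower_semicontinuous_majorant (psi : R -> R) (e : R) : 0 < e ->
  measurable_fun I psi -> (forall s, I s -> 0 <= psi s) ->
  exists Psi : R -> \bar R,
    [/\ measurable_fun I Psi, (forall s, I s -> (0 <= Psi s)%E),
      (\int[mu]_(x in I) Psi x <= \int[mu]_(x in I) (psi x)%:E + (e *+ 3)%:E)%E &
      forall s, I s -> exists2 d, 0 < d & forall x, I x -> `|x - s| < d ->
        ((psi s + e)%:E <= Psi x)%E].
Proof.
move=> e0 mpsi psi0.
have e20 : 0 <= e *+ 2 by rewrite mulrn_wge0// ltW.
have mI : measurable I by exact: measurable_itv.
have muI : mu I = 1%E by rewrite /I lebesgue_measure_itv/= lte_fin ltr01 sube0.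
pose E n := I `&` psi @^-1` `[n%:R * e, n.+1%:R * e[%classic.
have mE n : measurable (E n) by exact: mpsi.
have Efin n : (mu (E n) < +oo)%E.
  apply: (@le_lt_trans _ _ (mu I)); last by rewrite muI ltry.
  by apply: le_measure; [exact: (mem_set (mE n))|exact: (mem_set mI)|exact: subIsetl].
(* The factor [n.+2%:R^-1] cancels the height added on the excess, and the powers of 2 bring the
   total cost down to [e]. *)
pose d n : R := n.+2%:R^-1 * (2 ^ n.+1)%:R^-1.
have d0 n : 0 < d n by rewrite mulr_gt0// invr_gt0 ltr0n ?expn_gt0.
have /choice[U hU] n : exists U : set R,
    [/\ open U, E n `<=` U & (mu (U `\` E n) < (d n)%:E)%E].
  exact: lebesgue_regularity_outer (mE n) (Efin n) (d0 n).
have mUE n : measurable (U n `\` E n).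
  by apply: measurableD => //; apply: open_measurable; case: (hU n).
pose P2 x : \bar R := (\sum_(0 <= n <oo) (n.+2%:R * e * \1_(U n `\` E n) x)%:E)%E.
have t0 n x : (0 <= (n.+2%:R * e * \1_(U n `\` E n) x)%:E)%E.
  by rewrite lee_fin mulr_ge0// mulr_ge0// ltW.
have mt n : measurable_fun I (fun x => (n.+2%:R * e * \1_(U n `\` E n) x)%:E).
  by apply/measurable_EFinP; apply: measurable_funM => //; apply: measurable_indic.
have mP2 : measurable_fun I P2.
  by apply: ge0_emeasurable_sum => // n x _ _; exact: t0.
have P20 x : (0 <= P2 x)%E by apply: nneseries_ge0 => n _ _; exact: t0.
exists (fun x => (psi x + e *+ 2)%:E + P2 x)%E; split.
- apply: emeasurable_funD => //; apply/measurable_EFinP.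
  by apply: measurable_funD.
- move=> s Is; rewrite adde_ge0// lee_fin addr_ge0 ?psi0// e20.
- have m1 : measurable_fun I (EFin \o psi) by exact/measurable_EFinP.
  rewrite /= ge0_integralD//; last 2 first.
  + by move=> x Ix; rewrite lee_fin addr_ge0 ?psi0// e20.
  + by apply/measurable_EFinP; apply: measurable_funD.
  under eq_integral do rewrite EFinD.
  have ic : (\int[mu]_(_ in I) (e *+ 2)%:E = (e *+ 2)%:E)%E.
    by rewrite integral_cst// [X in (_ * X)%E]muI mule1.
  rewrite ge0_integralD//= ic -addeA; apply: leeD2l.
  have -> : ((e *+ 3)%:E = (e *+ 2)%:E + e%:E)%E by rewrite -EFinD -mulrSr.
  apply: leeD2l.
  rewrite integral_nneseries//.
  apply: (@le_trans _ _ (\sum_(0 <= n <oo) (0 + (e / (2 ^ n.+1)%:R)%:E))%E).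
    apply: lee_nneseries => n _; first by move=> _; apply: integral_ge0 => x _; exact: t0.
    rewrite add0e.
    under eq_integral do rewrite EFinM.
    rewrite ge0_integralZl//; last 2 first.
    + by apply/measurable_EFinP; exact: measurable_indic (mUE n).
    + by rewrite lee_fin mulr_ge0// ltW.
    rewrite integral_indic//; last exact: mUE.
    have -> : (e / (2 ^ n.+1)%:R)%:E = ((n.+2%:R * e)%:E * (d n)%:E)%E.
      by rewrite -EFinM /d mulrACA mulfV ?mul1r// pnatr_eq0.
    apply: lee_wpmul2l; first by rewrite lee_fin mulr_ge0// ltW.
    case: (hU n) => _ _ /ltW; apply: le_trans.
    apply: le_measure; [|apply: mem_set; exact: mUE|exact: subIsetl].
    by apply: mem_set; exact: measurableI (mUE n) mI.
  apply: le_trans (epsilon_trick _ _ _) _ => //; first exact: ltW.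
  by rewrite eseries0// add0e.
- move=> s Is.
  pose n := Num.truncn (psi s / e).
  have Ens : E n s.
    split=> //=; rewrite in_itv/=.
    have /truncn_itv : 0 <= psi s / e by rewrite divr_ge0 ?psi0// ltW.
    by rewrite -/n ler_pdivlMr// ltr_pdivrMr.
  have [oU EU _] := hU n.
  have [dl dl0 hd] : exists2 dl, 0 < dl & ball s dl `<=` U n.
    apply/nbhs_ballP; exact: (open_nbhs_nbhs (conj oU (EU _ Ens))).
  exists dl => // x Ix xs.
  have Ux : U n x by apply: hd; rewrite /ball/= distrC.
  have hs : psi s < n.+1%:R * e by case: Ens => _ /=; rewrite in_itv/= => /andP[].
  (* On [E n] two values of [psi] differ by less than [e], which the constant [e *+ 2] absorbs; off
     [E n] the summand of index [n] is large enough by itself. *)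
  have [Ex|Ex] := pselect (E n x).
    apply: (@le_trans _ _ (psi x + e *+ 2)%:E); last by rewrite leeDl.
    rewrite lee_fin.
    have hx : n%:R * e <= psi x by case: Ex => _ /=; rewrite in_itv/= => /andP[].
    move: hs; rewrite -natr1 mulrDl mul1r mulr2n => hs; lra.
  apply: (@le_trans _ _ (P2 x)); last first.
    by rewrite leeDr// lee_fin addr_ge0 ?psi0// e20.
  apply: (@le_trans _ _ (n.+2%:R * e * \1_(U n `\` E n) x)%:E).
    rewrite indicE mem_set// mulr1 lee_fin.
    move: hs; rewrite -!natr1 !mulrDl mul1r => hs; lra.
  apply: le_trans (nneseries_lim_ge n.+1 _); last by move=> k _ _; exact: t0.
  rewrite big_nat_recr//= leeDr// sume_ge0//.
Qed.


(** Continuous induction from 0 to 1. Since [psi] is only measurable, the slope at [s] says nothing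
    about nearby values of [psi]; the majorant does stay above [psi s + e / 3] around [s], so that
    short increments of [h] are bounded by its integral. *)
Lemma mean_value_integral (h psi : R -> R) :
  measurable_fun I psi -> (forall s, I s -> 0 <= psi s) ->
  (forall s e, I s -> 0 < e -> exists2 d, 0 < d & forall x, I x ->
    `|x - s| < d -> `|h x - h s| <= (psi s + e) * `|x - s|) ->
  ((h 1 - h 0)%:E <= \int[mu]_(x in I) (psi x)%:E)%E.
Proof.
move=> mpsi psi0 hh; apply/lee_addgt0Pr => e e0.
(* A third of [e], because the majorant costs three times its parameter. *)
have e30 : 0 < e / 3%:R by rewrite divr_gt0.
have [Psi [mPsi Psi0 intPsi lsc]] := lower_semicontinuous_majorant e30 mpsi psi0.
have -> : e = (e / 3%:R) *+ 3 by rewrite -mulr_natr mulfVK.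
apply: le_trans intPsi.
have mItv x y : measurable (`]x, y]%classic : set R) by exact: measurable_itv.
have subI x y : I x -> I y -> `]x, y]%classic `<=` I.
  rewrite /I /= !in_itv/= => /andP[x0 x1] /andP[y0 y1] z /=; rewrite !in_itv/=.
  by move=> /andP[xz zy]; rewrite (le_trans x0 (ltW xz)) (le_trans zy y1).
have mPsiI x y : I x -> I y -> measurable_fun `]x, y]%classic Psi.
  move=> Ix Iy; apply: measurable_funS mPsi; first exact: measurable_itv.
  exact: subI.
(* Only intervals with [s] as an endpoint are considered, since the slope hypothesis compares with
   [h s] alone. Half-open intervals make the integrals add up under concatenation. *)
have loc s : I s -> exists2 d, 0 < d & forall x y, I x -> I y -> x <= y ->
    s = x \/ s = y -> y - x < d ->
    ((h y - h x)%:E <= \int[mu]_(z in `]x, y]) Psi z)%E.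
  move=> Is.
  have [d1 d10 hd1] := hh s _ Is e30.
  have [d2 d20 hd2] := lsc s Is.
  exists (Num.min d1 d2); first by rewrite lt_min d10.
  move=> x y Ix Iy xy sxy; rewrite lt_min => /andP[yx1 yx2].
  have /le_trans : ((h y - h x)%:E <= (psi s + e / 3%:R)%:E * mu `]x, y])%E.
    rewrite lebesgue_measure_itv/= lte_fin.
    have : h y - h x <= (psi s + e / 3%:R) * (y - x).
      case: sxy => ?; subst s.
        have := hd1 y Iy; rewrite ger0_norm ?subr_ge0// => /(_ yx1).
        by apply: le_trans; rewrite ler_norm.
      have := hd1 x Ix; rewrite distrC ger0_norm ?subr_ge0// => /(_ yx1).
      by apply: le_trans; rewrite distrC ler_norm.
    move: xy; rewrite le_eqVlt => /predU1P[-> _|-> h1].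
      by rewrite ltxx subrr mule0.
    by rewrite -EFinB -EFinM lee_fin.
  apply.
  rewrite -integral_cst//; apply: ge0_le_integral => //.
  - by move=> z _; rewrite lee_fin addr_ge0 ?psi0// ltW.
  - exact: mPsiI.
  - move=> z zxy; apply: hd2; first exact: subI zxy.
    apply: le_lt_trans yx2; move: zxy; rewrite /= in_itv/= => /andP[xz zy].
    by case: sxy => ->; [rewrite ger0_norm|rewrite ler0_norm]; lra.
have cat x y : I x -> I y -> x <= y ->
    (\int[mu]_(z in `]0%R, y]) Psi z =
     \int[mu]_(z in `]0%R, x]) Psi z + \int[mu]_(z in `]x, y]) Psi z)%E.
  move=> Ix Iy xy.
  have I0 : I 0 by rewrite /I /= in_itv/= lexx ler01.
  have E : `]0, y]%classic = `]0, x]%classic `|` `]x, y]%classic.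
    apply/seteqP; split=> z /=; rewrite !in_itv/=.
      by move=> /andP[z0 zy]; case: (leP z x) => zx; [left|right]; rewrite ?z0 ?zx.
    move: Ix; rewrite /I /= in_itv/= => /andP[x0 _].
    move=> [/andP[-> zx]|/andP[xz ->]]; first by rewrite (le_trans zx).
    by rewrite (le_lt_trans x0 xz).
  rewrite E ge0_integral_setU//.
  - by rewrite -E; exact: mPsiI.
  - by rewrite -E => z zy; apply: Psi0; exact: subI zy.
  - apply/disj_setPRL => z /=; rewrite !in_itv/= => /andP[xz _].
    by apply/negP; rewrite negb_and -!leNgt -ltNge xz orbT.
(* The supremum [c] of [A] lies in [A], by [loc] on the left of [c]; if [c < 1], then [loc] on its
   right gives an element of [A] beyond [c]. *)
pose A := [set x | I x /\ ((h x - h 0)%:E <= \int[mu]_(z in `]0%R, x]) Psi z)%E].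
have I0 : I 0 by rewrite /I /= in_itv/= lexx ler01.
have I1 : I 1 by rewrite /I /= in_itv/= lexx ler01.
have A0 : A 0.
  split=> //; rewrite subrr integral_ge0// => z /=; rewrite in_itv/= => /andP[z0 zx].
  by have := lt_le_trans z0 zx; rewrite ltxx.
have ubA : ubound A 1 by move=> x [+ _]; rewrite /I /= in_itv/= => /andP[].
have supA : has_sup A by split; [exists 0|exists 1].
pose c := sup A.
have Ic : I c.
  rewrite /I /= in_itv/= /c; apply/andP; split; first exact: ub_le_sup (proj2 supA) _ A0.
  apply: ge_sup => //; by exists 0.
have [d d0 locc] := loc c Ic.
have Ac : A c.
  have [x Ax] := sup_adherent d0 supA; rewrite -/c => cx.
  have xc : x <= c by exact: ub_le_sup (proj2 supA) _ Ax.
  case: Ax => Ix Ax; split=> //.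
  rewrite (cat x c)// (_ : h c - h 0 = (h x - h 0) + (h c - h x)); last by ring.
  rewrite EFinD; apply: leeD => //; apply: locc => //; first by right.
  by rewrite ltrBlDr -ltrBlDl.
have [c1|c1] := leP 1 c.
  have {c1}c1 : c = 1.
    by apply/le_anti; rewrite c1 andbT; move: Ic; rewrite /I /= in_itv/= => /andP[].
  move: Ac; rewrite c1 => -[_ /le_trans]; apply.
  apply: ge0_subset_integral => //; [exact: measurable_itv|exact: subI].
pose y := Num.min 1 (c + d / 2).
have cy : c < y by rewrite lt_min c1 ltrDl divr_gt0.
have Iy : I y.
  rewrite /I /= in_itv/=; apply/andP; split; last by rewrite ge_min lexx.
  by apply: le_trans (ltW cy); move: Ic; rewrite /I /= in_itv/= => /andP[].
suff /(ub_le_sup (proj2 supA)) : A y by rewrite leNgt cy.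
split=> //; rewrite (cat c y)// ?(ltW cy)//.
rewrite (_ : h y - h 0 = (h c - h 0) + (h y - h c)); last by ring.
rewrite EFinD; apply: leeD; first by case: Ac.
apply: locc => //; [exact: ltW|by left|].
rewrite ltrBlDl; apply: (@le_lt_trans _ _ (c + d / 2)); first by rewrite ge_min lexx orbT.
by rewrite ltrD2l ltr_pdivrMr// ltr_pMr// ltr1n.
Qed.

End mean_value.

(** * Affine change of variables on the line *)

Section affine.
Context {R : realType}.
Local Notation mu := (@lebesgue_measure R).
Local Notation RR := (measurableTypeR R).

(** Lebesgue measure is [s] times its image under the affine map: the two measures agree on
    half-open intervals, hence everywhere by uniqueness. *)
Lemma ge0_integral_affine (F : RR -> \bar R) (a s : R) : 0 < s ->
  measurable_fun setT F -> (forall x, (0 <= F x)%E) ->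
  (\int[mu]_x F x = s%:E * \int[mu]_x F (a + s * x)%R)%E.
Proof.
move=> s0 mF F0.
have s0' : 0 <= s by exact: ltW.
pose f : RR -> RR := fun x => a + s * x.
have mf : measurable_fun setT f.
  by apply: measurable_funD => //; apply: measurable_funM.
pose pm : {measure set RR -> \bar R} :=
  measure_function_pushforward__canonical__measure_function_Measure mu mf.
pose m := mscale (NngNum s0') pm.
have mE A : measurable A -> mu A = m A.
  apply: lebesgue_measure_unique => _ [[x y] _ <-] /=.
  rewrite /m /mscale/= /pushforward.
  have -> : f @^-1` `]x, y]%classic = `](x - a) / s, (y - a) / s]%classic.
    apply/seteqP; split=> z /=; rewrite !in_itv/= /f ltr_pdivrMr// ler_pdivlMr//
      ltrBlDl lerBrDl mulrC; by [].
  rewrite !lebesgue_measure_itv/= !lte_fin ltr_pM2r ?invr_gt0// ltrBlDr subrK.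
  case: ifPn => _; last by rewrite mule0.
  by rewrite -!EFinB -EFinM -mulrBl opprB addrA subrK mulrCA mulfV ?mulr1// gt_eqF.
have -> : (\int[mu]_x F x = \int[m]_x F x)%E.
  by apply: eq_measure_integral => A mA _; exact: mE.
rewrite ge0_integral_mscale//=.
by rewrite ge0_integral_pushforward.
Qed.

End affine.

(** * Integrals over product spaces *)

(** Inversion is continuous off 0, and the point 0, where it takes the default value 0, is split off
    as a measurable singleton. *)
Lemma measurable_invr {R : realType} : measurable_fun [set: R] (@GRing.inv R).
Proof.
rewrite (_ : [set: R] = [set 0] `|` ~` [set 0]); last by rewrite setUv.
have m0 : measurable [set (0 : R)] by exact: measurable_set1.
apply/measurable_funU => //; [exact: measurableC m0|split].
- apply: (eq_measurable_fun (fun=> 0 : R)); last exact: measurable_cst.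
  by move=> x /set_mem /= ->; rewrite invr0.
- apply: open_continuous_measurable_fun.
    by apply: closed_openC; exact/accessible_closed_set1/hausdorff_accessible/Rhausdorff.
  by move=> x /set_mem /= /eqP x0; exact: inv_continuous.
Qed.

Lemma measurable_funV d (T : measurableType d) {R : realType} (D : set T) (f : T -> R) :
  measurable_fun D f -> measurable_fun D (fun x => (f x)^-1).
Proof. exact: measurableT_comp measurable_invr. Qed.

Section sigma_finite_product.
Local Open Scope ereal_scope.
Context d1 d2 (X : measurableType d1) (Y : measurableType d2) (R : realType).
Variables (nu : {sigma_finite_measure set X -> \bar R})
          (la : {sigma_finite_measure set Y -> \bar R}).

(* The library attaches the structure of sigma-finite measure to [nu \x la]
   only for sub-probabilities. *)
Definition sprod : set (X * Y) -> \bar R := nu \x la.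

HB.instance Definition _ := Measure.on sprod.

Let sprod_sigma_finite : sigma_finite setT sprod.
Proof.
have /sigma_finiteP[F [TF ndF Ffin]] := sigma_finiteT nu.
have /sigma_finiteP[G [TG ndG Gfin]] := sigma_finiteT la.
(* Both exhaustions are increasing, so the products of sets of equal index already cover the product
   space. *)
exists (fun n => F n `*` G n) => [|n].
  rewrite -setXTT TF TG; apply/seteqP; split=> [[x y] [/= [n _ Fx] [m _ Gy]]|].
    exists (maxn n m) => //; split => /=.
      by move: Fx; exact/subsetPset/ndF/leq_maxl.
    by move: Gy; exact/subsetPset/ndG/leq_maxr.
  by move=> [x y] [n _ [/= Fx Gy]]; split; exists n.
have [mF Foo] := Ffin n; have [mG Goo] := Gfin n.
split; first exact: measurableX.
by rewrite /sprod product_measure1E// lte_mul_pinfty// ge0_fin_numE.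
Qed.

HB.instance Definition _ :=
  Measure_isSigmaFinite.Build _ _ _ sprod sprod_sigma_finite.

Lemma sprodE A B : measurable A -> measurable B -> sprod (A `*` B) = nu A * la B.
Proof. exact: product_measure1E. Qed.

Lemma integral_sprod (f : X * Y -> \bar R) : measurable_fun setT f ->
  (forall z, 0 <= f z) ->
  \int[sprod]_z f z = \int[nu]_x \int[la]_y f (x, y).
Proof. exact: fubini_tonelli1. Qed.

End sigma_finite_product.

Section square.
Local Open Scope ereal_scope.
Context d1 d2 (X : measurableType d1) (Y : measurableType d2) (R : realType).
Variables (nu : {sigma_finite_measure set X -> \bar R})
          (la : {sigma_finite_measure set Y -> \bar R}).

(** The square of an integral is a double integral in [x] and [x']; Tonelli's theorem then moves the
    integration in [y] to the innermost place. *)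
Lemma ge0_integral_square (A : X -> Y -> \bar R) :
  measurable_fun setT (fun p : X * Y => A p.1 p.2) -> (forall x y, 0 <= A x y) ->
  \int[la]_y ((\int[nu]_x A x y) * (\int[nu]_x A x y)) =
  \int[nu]_x \int[nu]_x' \int[la]_y (A x y * A x' y).
Proof.
move=> mA A0.
have mAx y : measurable_fun setT (fun x => A x y).
  exact: (measurableT_comp mA (pair2_measurable y)).
have mAA : measurable_fun setT (fun p : (Y * X) * X => A p.1.2 p.1.1 * A p.2 p.1.1).
  have m1 : measurable_fun setT (fun p : (Y * X) * X => (p.1.2, p.1.1)).
    by apply: measurable_fun_pair; exact: measurableT_comp.
  have m2 : measurable_fun setT (fun p : (Y * X) * X => (p.2, p.1.1)).
    by apply: measurable_fun_pair => //; exact: measurableT_comp.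
  by apply: emeasurable_funM; [exact: measurableT_comp mA m1|exact: measurableT_comp mA m2].
have mI : measurable_fun setT (fun p : Y * X => \int[nu]_x' (A p.2 p.1 * A x' p.1)).
  by apply: (measurable_fun_fubini_tonelli_F _ mAA) => -[[y x] x']; exact: mule_ge0.
transitivity (\int[la]_y \int[nu]_x \int[nu]_x' (A x y * A x' y)).
  apply: eq_integral => y _.
  rewrite -ge0_integralZr//; last exact: integral_ge0.
  by apply: eq_integral => x _; rewrite -ge0_integralZl.
rewrite (fubini_tonelli (fun p : Y * X => \int[nu]_x' (A p.2 p.1 * A x' p.1)))//=; last first.
  by move=> p; apply: integral_ge0 => x _; exact: mule_ge0.
apply: eq_integral => x _.
rewrite (fubini_tonelli (fun p : Y * X => A x p.1 * A p.2 p.1))//=; last first.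
  by move=> p; exact: mule_ge0.
have -> : (fun p : Y * X => A x p.1 * A p.2 p.1) =
    (fun p : (Y * X) * X => A p.1.2 p.1.1 * A p.2 p.1.1) \o (fun p => ((p.1, x), p.2)).
  by [].
apply: measurableT_comp mAA _; apply: measurable_fun_pair => //.
exact: measurable_fun_pair.
Qed.


(** After expansion of the square, the two terms of the bound have the same double integral by
    Tonelli's theorem, whence the factor 2. *)
Lemma ge0_integral_square_le (A : X -> Y -> \bar R) (B : X -> X -> \bar R) :
  measurable_fun setT (fun p : X * Y => A p.1 p.2) -> (forall x y, 0 <= A x y) ->
  measurable_fun setT (fun p : X * X => B p.1 p.2) -> (forall x x', 0 <= B x x') ->
  (forall x x', \int[la]_y (A x y * A x' y) <= B x x' + B x' x) ->
  \int[la]_y ((\int[nu]_x A x y) * (\int[nu]_x A x y)) <=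
  2%:E * \int[nu]_x \int[nu]_x' B x x'.
Proof.
move=> mA A0 mB B0 AB; rewrite ge0_integral_square//.
have m : measurable_fun setT (fun z : (X * X) * Y => A z.1.1 z.2 * A z.1.2 z.2).
  have m1 : measurable_fun setT (fun z : (X * X) * Y => (z.1.1, z.2)).
    by apply: measurable_fun_pair => //; exact: measurableT_comp.
  have m2 : measurable_fun setT (fun z : (X * X) * Y => (z.1.2, z.2)).
    by apply: measurable_fun_pair => //; exact: measurableT_comp.
  by apply: emeasurable_funM; [exact: measurableT_comp mA m1|exact: measurableT_comp mA m2].
pose K (z : X * X) := \int[la]_y (A z.1 y * A z.2 y).
have K0 z : 0 <= K z by apply: integral_ge0 => y _; exact: mule_ge0.
have mK : measurable_fun setT K.
  by apply: (measurable_fun_fubini_tonelli_F _ m) => z; exact: mule_ge0.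
have msw : measurable_fun setT (fun z : X * X => (z.2, z.1)).
  exact: measurable_fun_pair.
have mBs : measurable_fun setT (fun z : X * X => B z.2 z.1).
  exact: (measurableT_comp mB msw).
have mB2 : measurable_fun setT (fun z : X * X => B z.1 z.2 + B z.2 z.1).
  exact: emeasurable_funD.
have mx (f : X * X -> \bar R) x : measurable_fun setT f ->
    measurable_fun setT (fun x' => f (x, x')).
  by move=> mf; exact: (measurableT_comp mf (pair1_measurable x)).
apply: (@le_trans _ _ (\int[nu]_x \int[nu]_x' (B x x' + B x' x))).
  apply: ge0_le_integral => //.
  - by move=> x _; apply: integral_ge0 => x' _; exact: (K0 (x, x')).
  - exact: (measurable_fun_fubini_tonelli_F _ mK).
  - by apply: (measurable_fun_fubini_tonelli_F _ mB2) => z; exact: adde_ge0.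
  - move=> x _; apply: ge0_le_integral => //.
    + by move=> x' _; exact: (K0 (x, x')).
    + exact: (mx _ x mK).
    + exact: (mx _ x mB2).
have -> : \int[nu]_x \int[nu]_x' (B x x' + B x' x) =
    \int[nu]_x \int[nu]_x' B x x' + \int[nu]_x \int[nu]_x' B x' x.
  rewrite -ge0_integralD//.
  - apply: eq_integral => x _; rewrite -ge0_integralD//.
    + exact: (mx _ x mB).
    + exact: (mx _ x mBs).
  - by move=> x _; exact: integral_ge0.
  - by apply: (measurable_fun_fubini_tonelli_F _ mB) => z.
  - by move=> x _; exact: integral_ge0.
  - by apply: (measurable_fun_fubini_tonelli_F _ mBs) => z.
rewrite -[X in _ + X <= _](fubini_tonelli (fun z : X * X => B z.1 z.2))//=.
by rewrite mule_natl mule2n.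
Qed.

End square.

(** * Energy of the cone weights *)

Section energy.
Context d (T : measurableType d) (R : realType) (P : probability T R).
Local Notation mu := (@lebesgue_measure R).
Local Notation RR := (measurableTypeR R).
Variables a b : T -> R.
Hypotheses (ma : measurable_fun setT a) (mb : measurable_fun setT b).
Hypotheses (a1 : forall t, `|a t| <= 1) (b1 : forall t, `|b t| <= 1).

(** The integrand of the kernel [K(w, p)] for [w = (a t, b t)], at the pair [x = (t, s)]. Keeping
    the scale [s] as a variable allows Tonelli's theorem to be applied jointly in [t] and [s]. *)
Definition cone_weight (x : T * RR) (p : RR * RR) : R :=
  if [&& 0 < x.2, x.2 <= 1, `|p.1 - (1 - x.2) * a x.1| <= x.2 / 2
       & `|p.2 - (1 - x.2) * b x.1| <= x.2 / 2] then (x.2 ^+ 2)^-1 else 0.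

(** The maximum norm fits the squares of the cones: whether two of them meet is decided coordinate
    by coordinate. *)
Definition maxdist (t t' : T) : R := Num.max `|a t - a t'| `|b t - b t'|.

Lemma cone_weight_ge0 x p : 0 <= cone_weight x p.
Proof. by rewrite /cone_weight; case: ifP => // _; rewrite invr_ge0 sqr_ge0. Qed.

Lemma measurable_cone_weight :
  measurable_fun setT (fun z : (T * RR) * (RR * RR) => cone_weight z.1 z.2).
Proof.
have mf1 : measurable_fun setT (fun z : (T * RR) * (RR * RR) => z.1.1).
  exact: measurableT_comp.
have mf2 : measurable_fun setT (fun z : (T * RR) * (RR * RR) => z.1.2).
  exact: measurableT_comp.
have mf3 : measurable_fun setT (fun z : (T * RR) * (RR * RR) => z.2.1).
  exact: measurableT_comp.
have mf4 : measurable_fun setT (fun z : (T * RR) * (RR * RR) => z.2.2).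
  exact: measurableT_comp.
have mdist (c : T -> R) (q : (T * RR) * (RR * RR) -> RR) : measurable_fun setT c ->
    measurable_fun setT q ->
    measurable_fun setT (fun z => `|q z - (1 - z.1.2) * c z.1.1| <= z.1.2 / 2).
  move=> mc mq; apply: measurable_fun_ler; last exact: measurable_funM.
  apply: measurableT_comp => //; apply: measurable_funB => //.
  apply: measurable_funM; first exact: measurable_funB.
  exact: measurableT_comp.
apply: measurable_fun_ifT => //.
- apply: measurable_and; first exact: measurable_fun_ltr.
  apply: measurable_and; first exact: measurable_fun_ler.
  by apply: measurable_and; exact: mdist.
- by apply: measurable_funV; exact: measurable_funX.
Qed.

(** The first argument carries the larger scale, so this is not symmetric; a pair of cone weights is
    bounded by the sum over both orders. *)
Definition overlap_bound (x x' : T * RR) : R :=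
  if [&& 0 < x.2, x.2 <= 1, 0 < x'.2, x'.2 <= x.2 & maxdist x.1 x'.1 <= 3 * x.2]
  then (x.2 ^+ 2)^-1 else 0.

Lemma overlap_bound_ge0 x x' : 0 <= overlap_bound x x'.
Proof. by rewrite /overlap_bound; case: ifP => // _; rewrite invr_ge0 sqr_ge0. Qed.

Lemma measurable_maxdist : measurable_fun setT (fun z : T * T => maxdist z.1 z.2).
Proof.
by apply: measurable_maxr; apply: measurableT_comp => //;
  apply: measurable_funB; exact: measurableT_comp.
Qed.

Lemma measurable_overlap_bound :
  measurable_fun setT (fun z : (T * RR) * (T * RR) => overlap_bound z.1 z.2).
Proof.
have m2 : measurable_fun setT (fun z : (T * RR) * (T * RR) => z.1.2).
  exact: measurableT_comp.
have m4 : measurable_fun setT (fun z : (T * RR) * (T * RR) => z.2.2).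
  exact: measurableT_comp.
apply: measurable_fun_ifT => //.
- do ![apply: measurable_and; first by [exact: measurable_fun_ltr|exact: measurable_fun_ler]].
  apply: measurable_fun_ler; last exact: measurable_funM.
  have mt : measurable_fun setT (fun z : (T * RR) * (T * RR) => (z.1.1, z.2.1)).
    by apply: measurable_fun_pair; exact: measurableT_comp.
  exact: (measurableT_comp measurable_maxdist mt).
- by apply: measurable_funV; exact: measurable_funX.
Qed.

(** The product of the weights is at most [s^-2 * s'^-2] on the smaller square, whose area is
    [s'^2]; this leaves [s^-2]. If the squares meet, their centres differ by at most [(s + s') / 2]
    in each coordinate, and replacing [(1 - s) c] by [c] costs [s], likewise [s'] for the other
    point: in all at most [3 * s]. *)
Let overlap_le (x x' : T * RR) : x'.2 <= x.2 ->
  (\int[sprod mu mu]_p (cone_weight x p * cone_weight x' p)%:E <=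
     (overlap_bound x x')%:E)%E.
Proof.
case: x x' => [t s] [t' s'] /= s's.
rewrite /overlap_bound/=.
case: ifPn => [/and5P[s0 s1 s'0 _ _]|hn].
  pose J (c : T -> R) : set RR := `[(1 - s') * c t' - s' / 2, (1 - s') * c t' + s' / 2]%classic.
  have muJ c : mu (J c) = s'%:E.
    rewrite /J lebesgue_measure_itv/= lte_fin.
    have -> : (1 - s') * c t' - s' / 2 < (1 - s') * c t' + s' / 2.
      by rewrite ltrD2l gt0_cp ?divr_gt0.
    by rewrite -EFinB; congr EFin; field.
  have mJ c : measurable (J c) by exact: measurable_itv.
  have mJJ : measurable (J a `*` J b) by exact: measurableX.
  have mcw : measurable_fun setT (fun p => cone_weight (t, s) p * cone_weight (t', s') p).
    apply: measurable_funM.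
      exact: (measurableT_comp measurable_cone_weight (pair1_measurable (t, s))).
    exact: (measurableT_comp measurable_cone_weight (pair1_measurable (t', s'))).
  apply: (@le_trans _ _ (\int[sprod mu mu]_p
      (((s ^+ 2)^-1 * (s' ^+ 2)^-1) * \1_(J a `*` J b) p)%:E)%E).
    apply: ge0_le_integral => //.
    - by move=> p _; rewrite lee_fin mulr_ge0// cone_weight_ge0.
    - exact/measurable_EFinP.
    - by apply/measurable_EFinP; apply: measurable_funM => //; exact: measurable_indic.
    move=> p _; rewrite lee_fin.
    have h1 : cone_weight (t, s) p <= (s ^+ 2)^-1.
      by rewrite /cone_weight; case: ifP => // _; rewrite invr_ge0 sqr_ge0.
    have h2 : cone_weight (t', s') p <= (s' ^+ 2)^-1 * \1_(J a `*` J b) p.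
      rewrite /cone_weight/=; case: ifPn => [/and4P[_ _ pa pb]|_].
        rewrite indicE mem_set ?mulr1//; split; rewrite /J /= in_itv/=.
          by move: pa; rewrite ler_distl.
        by move: pb; rewrite ler_distl.
      by rewrite mulr_ge0// invr_ge0 sqr_ge0.
    by rewrite -mulrA; apply: ler_pM => //; exact: cone_weight_ge0.
  under eq_integral do rewrite EFinM.
  rewrite ge0_integralZl//; last 2 first.
  - by apply/measurable_EFinP; exact: measurable_indic.
  - by rewrite lee_fin mulr_ge0// invr_ge0 sqr_ge0.
  rewrite integral_indic// setIT.
  have muJJ : sprod mu mu (J a `*` J b) = (s'%:E * s'%:E)%E.
    by rewrite sprodE// [X in (X * _)%E]muJ [X in (_ * X)%E]muJ.
  rewrite [X in (_ * X)%E]muJJ.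
  rewrite -!EFinM lee_fin -mulrA -expr2 mulVf ?mulr1//.
  by rewrite expf_neq0// gt_eqF.
rewrite integral0_eq// => p _; apply/eqP; rewrite eqe; apply/eqP.
rewrite /cone_weight/=.
case: ifPn => [/and4P[s0 s1 pa pb]|_]; last by rewrite mul0r.
case: ifPn => [/and4P[s'0 s'1 pa' pb']|_]; last by rewrite mulr0.
exfalso; move/negP: hn; apply; apply/and5P; split=> //.
have key (c : T -> R) q : `|c t| <= 1 -> `|c t'| <= 1 ->
    `|q - (1 - s) * c t| <= s / 2 -> `|q - (1 - s') * c t'| <= s' / 2 ->
    `|c t - c t'| <= 3 * s.
  rewrite !ler_norml => /andP[h1 h2] /andP[h3 h4] /andP[h5 h6] /andP[h7 h8].
  have u1 : s * c t <= s by rewrite ler_piMr ?(ltW s0).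
  have u2 : - s <= s * c t by rewrite -mulrN1 ler_pM2l.
  have u3 : s' * c t' <= s' by rewrite ler_piMr ?(ltW s'0).
  have u4 : - s' <= s' * c t' by rewrite -mulrN1 ler_pM2l.
  apply/andP; split; lra.
by rewrite /maxdist ge_max (key a p.1)//= (key b p.2).
Qed.


Lemma cone_overlap_le (x x' : T * RR) :
  (\int[sprod mu mu]_p ((cone_weight x p)%:E * (cone_weight x' p)%:E) <=
     (overlap_bound x x')%:E + (overlap_bound x' x)%:E)%E.
Proof.
under eq_integral do rewrite -EFinM.
case: (leP x'.2 x.2) => [xx'|/ltW xx'].
  by apply: (le_trans (overlap_le xx')); rewrite leeDl// lee_fin overlap_bound_ge0.
under eq_integral do rewrite mulrC.
by apply: (le_trans (overlap_le xx')); rewrite leeDr// lee_fin overlap_bound_ge0.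
Qed.

(** The integral of [ds / s] over the scales from [D / 3] to 1, that is [log (3 / D)] for
    [0 < D < 3], and [+oo] for [D = 0]. It is the logarithmic kernel in the form in which the cones
    produce it. *)
Definition log_bound (D : R) : \bar R :=
  (\int[mu]_s (if [&& 0 < s, s <= 1 & D <= 3 * s] then s^-1 else 0)%:E)%E.

(** The smaller scale ranges over an interval of length [s], which turns [s^-2] into [s^-1]. *)
Lemma integral_overlap_bound (t t' : T) (s : RR) :
  (\int[mu]_s' (overlap_bound (t, s) (t', s'))%:E =
   (if [&& (0 < s)%R, (s <= 1)%R & (maxdist t t' <= 3 * s)%R] then s^-1 else 0)%:E)%E.
Proof.
rewrite /overlap_bound/=.
case: ifPn => [/and3P[s0 s1 hD]|hn].
  transitivity (\int[mu]_s' ((s ^+ 2)^-1%:E * (\1_(`]0, s]%classic : set RR) s')%:E))%E.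
    apply: eq_integral => s' _; rewrite s0 s1 hD andbT/= -EFinM; congr EFin.
    rewrite indicE; have [s's|s's] := boolP (0 < s' <= s).
      by rewrite mem_set ?mulr1//= in_itv.
    by rewrite memNset ?mulr0//= in_itv/=; exact/negP.
  have mJ : measurable (`]0, s]%classic : set RR) by exact: measurable_itv.
  rewrite ge0_integralZl//; last 2 first.
  - by apply/measurable_EFinP; exact: measurable_indic.
  - by rewrite lee_fin invr_ge0 sqr_ge0.
  rewrite integral_indic// setIT.
  have muJ : mu `]0, s]%classic = s%:E.
    by rewrite lebesgue_measure_itv/= lte_fin s0 sube0.
  rewrite [X in (_ * X)%E]muJ -EFinM; congr EFin.
  by rewrite expr2 invfM -mulrA mulVf ?mulr1// gt_eqF.
rewrite integral0_eq// => s' _; case: ifPn => // /and5P[s0 s1 _ _ hD].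
by move/negP: hn; case; apply/and3P.
Qed.

(** The link between the square norm of the potential and the energy: [ge0_integral_square_le] with
    the overlap bound, followed by integration over both scales, smaller one first. *)
Lemma integral_cone_weight_square :
  (\int[sprod mu mu]_p ((\int[sprod P mu]_x (cone_weight x p)%:E) *
                     (\int[sprod P mu]_x (cone_weight x p)%:E)) <=
   2%:E * \int[P]_t \int[P]_t' log_bound (maxdist t t'))%E.
Proof.
have mW := measurable_cone_weight.
have mB := measurable_overlap_bound.
have mW' : measurable_fun setT
    (fun z : (T * RR) * (RR * RR) => (cone_weight z.1 z.2)%:E) by exact/measurable_EFinP.
have mB' : measurable_fun setT
    (fun z : (T * RR) * (T * RR) => (overlap_bound z.1 z.2)%:E) by exact/measurable_EFinP.
have B0 x x' : (0 <= (overlap_bound x x')%:E)%E by rewrite lee_fin overlap_bound_ge0.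
apply: le_trans.
  apply: (ge0_integral_square_le _ mW' _ mB' B0 cone_overlap_le) => x p.
  by rewrite lee_fin cone_weight_ge0.
apply: lee_wpmul2l => //.
have mx (f : (T * RR) * (T * RR) -> \bar R) x : measurable_fun setT f ->
    measurable_fun setT (fun x' => f (x, x')).
  by move=> mf; exact: (measurableT_comp mf (pair1_measurable x)).
suff -> : (\int[sprod P mu]_x \int[sprod P mu]_x' (overlap_bound x x')%:E =
    \int[P]_t \int[P]_t' log_bound (maxdist t t'))%E by [].
rewrite integral_sprod//; last 2 first.
- exact: (measurable_fun_fubini_tonelli_F _ mB').
- by move=> x; exact: integral_ge0.
rewrite /fubini_F; apply: eq_integral => t _.
transitivity (\int[mu]_s \int[P]_t' \int[mu]_s' (overlap_bound (t, s) (t', s'))%:E)%E.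
  apply: eq_integral => s _.
  by rewrite (integral_sprod _ _ (f := fun x' => (overlap_bound (t, s) x')%:E))//; exact: (mx _ (t, s) mB').
rewrite -(fubini_tonelli (fun z : T * RR => \int[mu]_s' (overlap_bound (t, z.2) (z.1, s'))%:E))%E//=.
- apply: eq_integral => t' _; apply: eq_integral => s _.
  exact: integral_overlap_bound.
- have m : measurable_fun setT (fun z : (T * RR) * RR =>
      (overlap_bound (t, z.1.2) (z.1.1, z.2))%:E).
    have m1 : measurable_fun setT (fun z : (T * RR) * RR => ((t, z.1.2), (z.1.1, z.2))).
      apply: measurable_fun_pair; apply: measurable_fun_pair => //; exact: measurableT_comp.
    exact: (measurableT_comp mB' m1).
  exact: (measurable_fun_fubini_tonelli_F _ m).
- by move=> z; exact: integral_ge0.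
Qed.

End energy.

(** * Comparison with the logarithm *)

Section log_bound.
Context {R : realType}.
Local Notation mu := (@lebesgue_measure R).
Local Notation RR := (measurableTypeR R).

Lemma measurable_log_bound_integrand (D : R) :
  measurable_fun setT (fun s : RR => if [&& 0 < s, s <= 1 & D <= 3 * s] then s^-1 else 0).
Proof.
apply: measurable_fun_ifT => //; last exact: measurable_invr.
apply: measurable_and; first exact: measurable_fun_ltr.
apply: measurable_and; first exact: measurable_fun_ler.
by apply: measurable_fun_ler => //; exact: measurable_funM.
Qed.

Lemma integral_inv (c : R) : 0 < c -> c < 1 ->
  (\int[mu]_(s in `[c, 1%R]) (s^-1)%:E = (ln c^-1)%:E)%E.
Proof.
move=> c0 c1.
rewrite (@continuous_FTC2 _ (fun s => s^-1) (@ln R))//.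
- by rewrite ln1 sub0e -EFinN lnV.
- apply: continuous_in_subspaceT => s /set_mem /=; rewrite in_itv/= => /andP[cs _].
  by apply: inv_continuous; rewrite gt_eqF// (lt_le_trans c0).
- split.
  + move=> s; rewrite in_itv/= => /andP[cs _].
    by have [] := is_derive1_ln (lt_trans c0 cs).
  + by apply: cvg_at_right_filter; exact: continuous_ln.
  + by apply: cvg_at_left_filter; exact: continuous_ln.
- move=> s; rewrite in_itv/= => /andP[cs _].
  have [] := is_derive1_ln (lt_trans c0 cs) => _.
  by rewrite derive1E.
Qed.

Lemma log_bound_le (D : R) : 0 < D -> D < 3 ->
  (log_bound D <= (ln (3 / D))%:E)%E.
Proof.
move=> D0 D3.
have c0 : 0 < D / 3 by rewrite divr_gt0.
have c1 : D / 3 < 1 by rewrite ltr_pdivrMr// mul1r.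
rewrite -invf_div -(integral_inv c0 c1) /log_bound.
rewrite [leRHS]integral_mkcond; apply: ge0_le_integral => //.
- by move=> s _; rewrite lee_fin; case: ifP => // /andP[s0 _]; rewrite invr_ge0 ltW.
- by apply/measurable_EFinP; exact: measurable_log_bound_integrand.
- apply/(measurable_restrictT _ (measurable_itv _)).
  by apply/measurable_EFinP; apply: measurable_funS (@measurable_invr R).
- move=> s _; rewrite patchE; case: ifPn => [/and3P[s0 s1 h]|_].
    rewrite mem_set//= in_itv/= s1 andbT ler_pdivrMr// mulrC//.
  by case: ifPn => // /set_mem /=; rewrite in_itv/= lee_fin invr_ge0 => /andP[/(lt_le_trans c0)/ltW].
Qed.

End log_bound.

(** * The real-valued modulus on the complex plane *)

Section complex_modulus.
Context {R : realType}.
Implicit Types z w : Cplx R.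
Local Open Scope complex_scope.

Lemma normr_normc z : `|z| = (Normc.normc z)%:C.
Proof. by case: z. Qed.

Lemma normc_ge0 z : 0 <= Normc.normc z.
Proof. by case: z => x y /=; exact: sqrtr_ge0. Qed.

Lemma unit_diskE z : unit_disk z <-> Normc.normc z < 1.
Proof. by rewrite /unit_disk/= normr_normc ltcR. Qed.

Lemma unit_circleE z : unit_circle z <-> Normc.normc z = 1.
Proof.
rewrite /unit_circle/= normr_normc; split=> [/(congr1 (@complex.Re R))//|->//].
Qed.

Lemma Re_le_normc z : `|complex.Re z| <= Normc.normc z.
Proof.
by case: z => x y /=; rewrite -sqrtr_sqr ler_wsqrtr// lerDl sqr_ge0.
Qed.

Lemma Im_le_normc z : `|complex.Im z| <= Normc.normc z.
Proof.
by case: z => x y /=; rewrite -sqrtr_sqr ler_wsqrtr// lerDr sqr_ge0.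
Qed.

Lemma normc_le_max z : Normc.normc z <= 2 * Num.max `|complex.Re z| `|complex.Im z|.
Proof.
case: z => x y /=; set m := Num.max _ _.
have m0 : 0 <= m by rewrite le_max normr_ge0.
have hx : x ^+ 2 <= m ^+ 2 by rewrite -real_normK ?num_real// lerXn2r ?nnegrE// le_max lexx.
have hy : y ^+ 2 <= m ^+ 2 by rewrite -real_normK ?num_real// lerXn2r ?nnegrE// le_max lexx orbT.
rewrite -(ler_pXn2r (n := 2))// ?nnegrE ?sqrtr_ge0 ?mulr_ge0//.
rewrite sqr_sqrtr ?addr_ge0 ?sqr_ge0// exprMn.
have : 0 <= m ^+ 2 by exact: sqr_ge0.
lra.
Qed.

End complex_modulus.

(** * Complex derivatives and measurability *)

Section complex_derivative.
Context {R : realType}.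
Implicit Types (z w : Cplx R) (g : Cplx R -> Cplx R).
Local Open Scope complex_scope.

Lemma normcB_sym z w : Normc.normc (z - w) = Normc.normc (w - z).
Proof. by rewrite -normcN opprB. Qed.

Lemma normcD_le z w : Normc.normc (z + w) <= Normc.normc z + Normc.normc w.
Proof. exact: le_normcD. Qed.

(** Balls of [Cplx R] have radii in [R[i]], but a positive element of [R[i]] is real. Later
    estimates can thus use real radii and [Normc.normc]. *)
Lemma nbhs_normcP z (A : set (Cplx R)) :
  nbhs z A <-> exists2 d : R, 0 < d & forall w, Normc.normc (w - z) < d -> A w.
Proof.
split=> [/nbhs_ballP[e /= e0 hA]|[d d0 hA]].
  move: e0; rewrite ltcE/= => /andP[/eqP ie re].
  have eE : e = (complex.Re e)%:C by case: e ie {re hA} => x y /= ->.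
  exists (complex.Re e) => // w wz; apply: hA.
  by rewrite /ball/= eE normr_normc ltcR normcB_sym.
apply/nbhs_ballP; exists d%:C; first by rewrite /= ltcR.
by move=> w; rewrite /ball/= normr_normc ltcR normcB_sym; exact: hA.
Qed.

(** The limit of the difference quotient, multiplied out by [w - z] so that [w = z] is included. *)
Lemma derivable_normc g z : derivable g z 1 -> forall e : R, 0 < e ->
  exists2 d : R, 0 < d & forall w, Normc.normc (w - z) < d ->
    Normc.normc (g w - g z - (w - z) * derive1 g z) <= e * Normc.normc (w - z).
Proof.
move=> dg e e0.
have : (h^-1 *: (g (h + z) - g z) @[h --> (0 : Cplx R)^'] --> derive1 g z).
  move: dg; rewrite /derivable /derive1 /=.
  by under eq_fun do rewrite /GRing.scale/= mulr1.
move=> /cvgrPdist_lt/(_ e%:C); rewrite ltcR => /(_ e0).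
move=> /nbhs_normcP[d d0 hd]; exists d => // w wz.
have [->|wNz] := eqVneq w z; first by rewrite !subrr mul0r subrr Normc.normc0 mulr0.
have wz0 : w - z != 0 by rewrite subr_eq0.
have := hd (w - z); rewrite subr0 => /(_ wz wz0); rewrite subrK normr_normc ltcR => /ltW h.
have -> : g w - g z - (w - z) * derive1 g z =
    (w - z) * - (derive1 g z - (w - z)^-1 *: (g w - g z)).
  by rewrite opprB mulrBr /GRing.scale/= mulrA mulfV// mul1r.
by rewrite Normc.normcM normcN mulrC ler_wpM2r ?normc_ge0.
Qed.

(** This is the slope condition that [mean_value_integral] asks for, with the modulus of the
    derivative as [psi]. *)
Lemma derivable_lipschitz g z : derivable g z 1 -> forall e : R, 0 < e ->
  exists2 d : R, 0 < d & forall w, Normc.normc (w - z) < d ->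
    Normc.normc (g w - g z) <= (Normc.normc (derive1 g z) + e) * Normc.normc (w - z).
Proof.
move=> dg e e0; have [d d0 hd] := derivable_normc dg e0; exists d => // w /hd h.
rewrite -[g w - g z](subrK ((w - z) * derive1 g z)).
apply: (le_trans (normcD_le _ _)).
by rewrite Normc.normcM [leRHS]mulrDl [leRHS]addrC [X in _ + X <= _]mulrC lerD2r.
Qed.

Lemma derivable_continuousP g z : derivable g z 1 -> forall e : R, 0 < e ->
  exists2 d : R, 0 < d & forall w, Normc.normc (w - z) < d ->
    Normc.normc (g w - g z) < e.
Proof.
move=> dg e e0; have [d d0 hd] := derivable_lipschitz dg ltr01.
set c := Normc.normc (derive1 g z) + 1 in hd.
have c0 : 0 < c by rewrite ltr_wpDl ?normc_ge0.
exists (Num.min d (e / c)); first by rewrite lt_min d0 divr_gt0.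
move=> w; rewrite lt_min => /andP[/hd h1 h2]; apply: le_lt_trans h1 _.
by rewrite mulrC -ltr_pdivlMr.
Qed.

End complex_derivative.

(** * Measurability in the plane *)

Section measurable_plane.
Context {R : realType}.
Local Notation RR := (measurableTypeR R).

(** An open set is the countable union of the squares with rational centre and half-side
    [n.+1%:R^-1] that it contains, and squares are measurable rectangles. *)
Lemma measurable_open_plane (U : set (RR * RR)) :
  (forall p, U p -> exists2 e : R, 0 < e &
    forall q : RR * RR, `|q.1 - p.1| < e -> `|q.2 - p.2| < e -> U q) ->
  measurable U.
Proof.
move=> oU.
pose sq (a b d : R) : set (RR * RR) := `]a - d, a + d[%classic `*` `]b - d, b + d[%classic.
have sqE a b d q : sq a b d q <-> `|q.1 - a| < d /\ `|q.2 - b| < d.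
  by rewrite /sq /= !in_itv/= !ltr_distl.
pose V (a b : rat) (n : nat) := if `[< sq (ratr a) (ratr b) n.+1%:R^-1 `<=` U >]
  then sq (ratr a) (ratr b) n.+1%:R^-1 else set0.
have -> : U = \bigcup_a \bigcup_b \bigcup_n V a b n.
  apply/seteqP; split=> [p Up|p [a _ [b _ [n _]]]]; last first.
    by rewrite /V; case: asboolP => // + hp; apply.
  have [e e0 he] := oU p Up.
  have e20 : 0 < e / 2 by rewrite divr_gt0.
  have [n hn] : exists n : nat, n.+1%:R^-1 < e / 2.
    have [n _ hn] := near_infty_natSinv_lt (PosNum e20).
    by exists n; exact: hn (leqnn n).
  set d : R := n.+1%:R^-1 in hn.
  have d0 : 0 < d by rewrite invr_gt0.
  have rat_near (x : R) : exists a : rat, `|x - ratr a| < d.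
    have [|a] := @rat_in_itvoo R (x - d) (x + d); first by rewrite ltrD2l gt0_cp.
    by rewrite in_itv/= => h; exists a; rewrite distrC ltr_distl.
  have [a ha] := rat_near p.1; have [b hb] := rat_near p.2.
  exists a => //; exists b => //; exists n => //; rewrite /V.
  case: asboolP => [_|[]]; first exact/sqE.
  move=> q /sqE; rewrite -/d => -[qa qb]; apply: he.
    apply: le_lt_trans (ler_distD (ratr a) _ _) _; rewrite [ltRHS]splitr.
    by apply: ltrD; apply: lt_trans hn => //; rewrite distrC.
  apply: le_lt_trans (ler_distD (ratr b) _ _) _; rewrite [ltRHS]splitr.
  by apply: ltrD; apply: lt_trans hn => //; rewrite distrC.
apply: bigcupT_measurable_rat => a; apply: bigcupT_measurable_rat => b.
apply: bigcupT_measurable => n; rewrite /V; case: ifP => // _.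
by apply: measurableX; exact: measurable_itv.
Qed.

Lemma measurable_fun_plane (U : set (RR * RR)) (f : RR * RR -> RR) :
  (forall p, U p -> exists2 e : R, 0 < e &
    forall q : RR * RR, `|q.1 - p.1| < e -> `|q.2 - p.2| < e -> U q) ->
  (forall p e, U p -> 0 < e -> exists2 d : R, 0 < d &
    forall q : RR * RR, `|q.1 - p.1| < d -> `|q.2 - p.2| < d -> `|f q - f p| < e) ->
  measurable_fun U f.
Proof.
move=> oU cf; apply: (measurability _ (RGenOInfty.measurableE R)).
move=> _ [_ [x ->] <-]; apply: measurable_open_plane => p [Up /=].
rewrite in_itv/= andbT => xp.
have [e e0 he] := oU p Up.
have [d d0 hd] := cf p (f p - x) Up ltac:(by rewrite subr_gt0).
exists (Num.min e d); first by rewrite lt_min e0.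
move=> q; rewrite !lt_min => /andP[q1 q1'] /andP[q2 q2']; split; first exact: he.
rewrite /= in_itv/= andbT; have := hd q q1' q2'.
by rewrite ltr_distl opprB addrCA subrr addr0 => /andP[].
Qed.

End measurable_plane.

(** * The modulus of the derivative as a function on the plane *)

Section gradient.
Context {R : realType}.
Local Notation mu := (@lebesgue_measure R).
Local Notation RR := (measurableTypeR R).
Local Open Scope complex_scope.
Implicit Types (g : Cplx R -> Cplx R) (p q : RR * RR).

Definition cpoint p : Cplx R := p.1 +i* p.2.

Definition plane_disk : set (RR * RR) := [set p | unit_disk (cpoint p)].

Lemma normc_cpointB p q (e : R) : `|q.1 - p.1| < e -> `|q.2 - p.2| < e ->
  Normc.normc (cpoint q - cpoint p) < 2 * e.
Proof.
move=> h1 h2; apply: le_lt_trans (normc_le_max _) _.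
by rewrite ltr_pM2l// gt_max h1.
Qed.

Lemma normcB_ge (z w : Cplx R) : `|Normc.normc z - Normc.normc w| <= Normc.normc (z - w).
Proof.
rewrite ler_norml; apply/andP; split.
  by rewrite lerNl opprB lerBlDr normcB_sym (le_trans _ (normcD_le _ _))// subrK.
by rewrite lerBlDr (le_trans _ (normcD_le _ _))// subrK.
Qed.

Lemma plane_disk_open p : plane_disk p -> exists2 e : R, 0 < e &
  forall q, `|q.1 - p.1| < e -> `|q.2 - p.2| < e -> plane_disk q.
Proof.
move=> /unit_diskE p1; exists ((1 - Normc.normc (cpoint p)) / 2).
  by rewrite divr_gt0// subr_gt0.
move=> q h1 h2; apply/unit_diskE.
have := normc_cpointB h1 h2; rewrite [ltRHS]mulrC divfK// ltrBrDr => h.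
by apply: le_lt_trans h; rewrite (le_trans _ (normcD_le _ _))// subrK.
Qed.

Lemma measurable_plane_disk : measurable plane_disk.
Proof. by apply: measurable_open_plane => p; exact: plane_disk_open. Qed.

Lemma measurable_fun_disk (u : Cplx R -> R) :
  (forall z e, unit_disk z -> 0 < e -> exists2 d : R, 0 < d &
    forall w, Normc.normc (w - z) < d -> `|u w - u z| < e) ->
  measurable_fun plane_disk (fun p => u (cpoint p)).
Proof.
move=> cu; apply: measurable_fun_plane; first exact: plane_disk_open.
move=> p e Dp e0; have [d d0 hd] := cu _ _ Dp e0.
exists (d / 2); first by rewrite divr_gt0.
move=> q h1 h2; apply: hd.
by have := normc_cpointB h1 h2; rewrite [ltRHS]mulrC divfK.
Qed.

(** Extended by zero off the disk, so that integrals may run over the whole plane. *)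
Definition disk_gradient g : RR * RR -> RR :=
  (fun p => Normc.normc (derive1 g (cpoint p))) \_ plane_disk.

Lemma disk_gradient_ge0 g p : 0 <= disk_gradient g p.
Proof. by rewrite /disk_gradient patchE; case: ifP => // _; exact: normc_ge0. Qed.

(** The modulus of the derivative is the pointwise limit of difference quotients, which are
    measurable because [g] is continuous on the disk. Continuity of the derivative is not
    invoked. *)
Lemma measurable_disk_gradient g : analytic_on_disk g ->
  measurable_fun setT (disk_gradient g).
Proof.
move=> ag; apply/(measurable_restrictT _ measurable_plane_disk).
pose G1 := (fun p => complex.Re (g (cpoint p))) \_ plane_disk.
pose G2 := (fun p => complex.Im (g (cpoint p))) \_ plane_disk.
have mG1 : measurable_fun setT G1.
  apply/(measurable_restrictT _ measurable_plane_disk).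
  apply: (@measurable_fun_disk (fun z => complex.Re (g z))) => z e Dz e0.
  have [d d0 hd] := derivable_continuousP (ag _ Dz) e0; exists d => // w /hd.
  apply: le_lt_trans; rewrite -raddfB; exact: Re_le_normc.
have mG2 : measurable_fun setT G2.
  apply/(measurable_restrictT _ measurable_plane_disk).
  apply: (@measurable_fun_disk (fun z => complex.Im (g z))) => z e Dz e0.
  have [d d0 hd] := derivable_continuousP (ag _ Dz) e0; exists d => // w /hd.
  apply: le_lt_trans; rewrite -raddfB; exact: Im_le_normc.
(* A horizontal shift by [n.+1%:R^-1]. It may leave the disk for small [n], where [G1] and [G2] have
   the value 0; at a given point of the disk it eventually stays inside. *)
pose tau (n : nat) p : RR * RR := (p.1 + n.+1%:R^-1, p.2).
have mtau n : measurable_fun setT (tau n).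
  by apply: measurable_fun_pair => //; apply: measurable_funD.
pose F n p : R := n.+1%:R *
  Num.sqrt ((G1 (tau n p) - G1 p) ^+ 2 + (G2 (tau n p) - G2 p) ^+ 2).
have msqrt : measurable_fun setT (@Num.sqrt R).
  exact: (continuous_measurable_fun (@sqrt_continuous R)).
have mF n : measurable_fun plane_disk (F n).
  apply: measurable_funTS; apply: measurable_funM => //.
  apply: (measurableT_comp msqrt); apply: measurable_funD; apply: measurable_funX;
    apply: measurable_funB => //.
    exact: (measurableT_comp mG1 (mtau n)).
  exact: (measurableT_comp mG2 (mtau n)).
apply: (measurable_fun_cvg mF) => p Dp.
apply/cvgrPdist_lt => e e0.
have e20 : 0 < e / 2 by rewrite divr_gt0.
have [d d0 hd] := derivable_normc (ag _ Dp) e20.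
have [r r0 hr] := plane_disk_open Dp.
have m0 : 0 < Num.min d r by rewrite lt_min d0.
have [N _ hN] := near_infty_natSinv_lt (PosNum m0).
exists N => // n /hN /=; rewrite lt_min => /andP[nd nr].
set h : R := n.+1%:R^-1 in nd nr.
have h0 : 0 < h by rewrite invr_gt0.
have Dt : plane_disk (tau n p).
  by apply: hr; rewrite /tau/= -/h ?subrr ?normr0// addrAC subrr add0r ger0_norm// ltW.
have tE : cpoint (tau n p) - cpoint p = h%:C.
  by rewrite /cpoint /tau/= -/h; simpc; rewrite addrAC subrr add0r.
have hC : Normc.normc (h%:C : Cplx R) = h.
  by rewrite /= expr0n/= addr0 sqrtr_sqr ger0_norm// ltW.
have FE : F n p = h^-1 * Normc.normc (g (cpoint (tau n p)) - g (cpoint p)).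
  rewrite /F /G1 /G2 !patchE (mem_set Dp) (mem_set Dt) /h invrK; congr (_ * _).
  by case: (g (cpoint (tau n p))) => a b; case: (g (cpoint p)).
have := hd (cpoint (tau n p)); rewrite tE hC => /(_ nd) hh.
rewrite FE distrC.
have -> : Normc.normc (derive1 g (cpoint p)) =
    h^-1 * Normc.normc (h%:C * derive1 g (cpoint p)).
  by rewrite Normc.normcM hC mulrA mulVf ?mul1r// gt_eqF.
rewrite -mulrBr normrM gtr0_norm ?invr_gt0// mulrC ltr_pdivrMr//.
apply: le_lt_trans (normcB_ge _ _) _; apply: le_lt_trans hh _.
by rewrite ltr_pM2r// ltr_pdivrMr// ltr_pMr// ltr1n.
Qed.

End gradient.

(** * Averages over cones *)

Section cone_average.
Context {R : realType}.
Local Notation mu := (@lebesgue_measure R).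
Local Notation RR := (measurableTypeR R).
Local Open Scope complex_scope.
Implicit Types (g : Cplx R -> Cplx R) (p q w y : RR * RR).

(** The segment starts at [w] for [s = 0]. For fixed [s] the map in [y] contracts by the factor [s]
    and sends the unit square around 0 to the square of side [s] centred at [(1 - s) w]. *)
Definition segment_point w y (s : RR) : RR * RR :=
  ((1 - s) * w.1 + s * y.1, (1 - s) * w.2 + s * y.2).

Lemma normc_real (x : R) : Normc.normc (x%:C : Cplx R) = `|x|.
Proof. by rewrite /= expr0n/= addr0 sqrtr_sqr. Qed.

Lemma cpoint_segment_point w y s :
  cpoint (segment_point w y s) = (1 - s)%:C * cpoint w + s%:C * cpoint y.
Proof. by rewrite /cpoint/=; simpc. Qed.

Lemma plane_disk_segment_point w y s : plane_disk w -> plane_disk y ->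
  0 <= s <= 1 -> plane_disk (segment_point w y s).
Proof.
move=> /unit_diskE w1 /unit_diskE y1 /andP[s0 s1]; apply/unit_diskE.
rewrite cpoint_segment_point; apply: le_lt_trans (normcD_le _ _) _.
rewrite !Normc.normcM !normc_real ger0_norm ?subr_ge0// ger0_norm//.
have [->|sN0] := eqVneq s 0; first by rewrite subr0 mul1r mul0r addr0.
have s0' : 0 < s by rewrite lt_def sN0.
rewrite [ltRHS](_ : 1 = (1 - s) * 1 + s * 1); last by ring.
by apply: ler_ltD; [rewrite ler_wpM2l ?subr_ge0// ltW|rewrite ltr_pM2l].
Qed.

Lemma measurable_segment_point w :
  measurable_fun setT (fun z : (RR * RR) * RR => segment_point w z.1 z.2).
Proof.
have m1 : measurable_fun setT (fun z : (RR * RR) * RR => z.1.1).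
  exact: measurableT_comp.
have m2 : measurable_fun setT (fun z : (RR * RR) * RR => z.1.2).
  exact: measurableT_comp.
apply: measurable_fun_pair; apply: measurable_funD; apply: measurable_funM => //;
  by apply: measurable_funB.
Qed.

(** The mean value inequality along the segment, for the opposite of the real part because the
    segment runs from [w] to [y]. The factor 2 bounds the length of the segment. *)
Lemma Re_increment_le g w y : analytic_on_disk g -> plane_disk w -> plane_disk y ->
  ((complex.Re (g (cpoint w)) - complex.Re (g (cpoint y)))%:E <=
    \int[mu]_(s in `[0%R, 1%R]) (2 * disk_gradient g (segment_point w y s))%:E)%E.
Proof.
move=> ag Dw Dy.
pose h (s : R) : R := - complex.Re (g (cpoint (segment_point w y s))).
have h0 : h 0 = - complex.Re (g (cpoint w)).
  by rewrite /h cpoint_segment_point subr0 mul1r mul0r addr0.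
have h1 : h 1 = - complex.Re (g (cpoint y)).
  by rewrite /h cpoint_segment_point subrr mul1r mul0r add0r.
have -> : complex.Re (g (cpoint w)) - complex.Re (g (cpoint y)) = h 1 - h 0.
  by rewrite h0 h1 opprK addrC.
apply: mean_value_integral.
- apply: measurable_funTS; apply: measurable_funM => //.
  have ms := measurableT_comp (measurable_segment_point w) (pair1_measurable y).
  exact: (measurableT_comp (measurable_disk_gradient ag) ms).
- by move=> s _; rewrite mulr_ge0// disk_gradient_ge0.
move=> s e Is e0.
have Ds : plane_disk (segment_point w y s) by exact: plane_disk_segment_point.
have e20 : 0 < e / 2 by rewrite divr_gt0.
have [d d0 hd] := derivable_lipschitz (ag _ Ds) e20.
exists (d / 2); first by rewrite divr_gt0.
move=> x Ix xs.
have wy2 : Normc.normc (cpoint y - cpoint w) <= 2.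
  have /unit_diskE/ltW := Dw; have /unit_diskE/ltW := Dy => hy hw.
  by rewrite (le_trans (normcD_le _ _))// normcN -[2]/(1 + 1) lerD.
have xsE : Normc.normc (cpoint (segment_point w y x) - cpoint (segment_point w y s)) <=
    2 * `|x - s|.
  rewrite !cpoint_segment_point.
  have -> : (1 - x)%:C * cpoint w + x%:C * cpoint y -
      ((1 - s)%:C * cpoint w + s%:C * cpoint y) = (x - s)%:C * (cpoint y - cpoint w).
    by rewrite !rmorphB/= rmorph1; ring.
  by rewrite Normc.normcM normc_real mulrC ler_wpM2r.
have lt_d : Normc.normc (cpoint (segment_point w y x) - cpoint (segment_point w y s)) < d.
  by apply: le_lt_trans xsE _; rewrite mulrC -ltr_pdivlMr.
have hx : `|h x - h s| <= Normc.normc (g (cpoint (segment_point w y x)) -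
    g (cpoint (segment_point w y s))).
  by rewrite /h -opprD normrN -raddfB; exact: Re_le_normc.
apply: (le_trans hx); apply: (le_trans (hd _ lt_d)).
have -> : disk_gradient g (segment_point w y s) =
    Normc.normc (derive1 g (cpoint (segment_point w y s))).
  by rewrite /disk_gradient patchE mem_set.
set c := Normc.normc (derive1 g _).
have c0 : 0 <= c by exact: normc_ge0.
have -> : (2 * c + e) * `|x - s| = (c + e / 2) * (2 * `|x - s|) by field.
by rewrite ler_wpM2l// addr_ge0// ltW.
Qed.

Lemma ge0_integral_affine_plane (F : RR * RR -> \bar R) (c : RR * RR) (s : R) :
  0 < s -> measurable_fun setT F -> (forall p, (0 <= F p)%E) ->
  (\int[sprod mu mu]_p F p =
   (s ^+ 2)%:E * \int[sprod mu mu]_p F (c.1 + s * p.1, c.2 + s * p.2)%R)%E.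
Proof.
move=> s0 mF F0.
have mline (a : R) : measurable_fun setT (fun x : RR => a + s * x).
  by apply: measurable_funD => //; exact: measurable_funM.
have mG : measurable_fun setT (fun p : RR * RR => (p.1, c.2 + s * p.2)).
  apply: measurable_fun_pair => //; apply: measurable_funD => //; exact: measurable_funM.
have mH : measurable_fun setT (fun p : RR * RR => (c.1 + s * p.1, c.2 + s * p.2)).
  by apply: measurable_fun_pair; apply: measurable_funD => //; exact: measurable_funM.
rewrite !integral_sprod//=; last exact: (measurableT_comp mF mH).
transitivity (\int[mu]_x (s%:E * \int[mu]_y F (x, c.2 + s * y)%R))%E.
  apply: eq_integral => x _; apply: (ge0_integral_affine c.2 s0) => //.
  exact: (measurableT_comp mF (pair1_measurable x)).
have mI : measurable_fun setT (fun x => \int[mu]_y F (x, c.2 + s * y)%R)%E.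
  have mFG := measurableT_comp mF mG.
  by apply: (measurable_fun_fubini_tonelli_F _ mFG) => z; exact: F0.
rewrite ge0_integralZl//; last 2 first.
- by move=> x _; exact: integral_ge0.
- by rewrite lee_fin ltW.
rewrite (ge0_integral_affine c.1 s0)//; last by move=> x; exact: integral_ge0.
by rewrite muleA -EFinM -expr2.
Qed.

End cone_average.

(** * From averages along segments to the cone kernel *)

Section cone_potential.
Context d (T : measurableType d) (R : realType) (P : probability T R).
Local Notation mu := (@lebesgue_measure R).
Local Notation RR := (measurableTypeR R).
Variables a b : T -> R.
Hypotheses (ma : measurable_fun setT a) (mb : measurable_fun setT b).
Hypotheses (a1 : forall t, `|a t| <= 1) (b1 : forall t, `|b t| <= 1).
Local Notation cw := (cone_weight a b).

(** Its area is 1, so that averaging over it is plain integration, and its closure stays inside the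
    disk. *)
Definition half_square : set (RR * RR) :=
  [set y | (`|y.1| <= 2^-1) && (`|y.2| <= 2^-1)].

Lemma half_squareE : half_square = `[- 2^-1, 2^-1]%classic `*` `[- 2^-1, 2^-1]%classic.
Proof.
apply/seteqP; split=> y; rewrite /half_square/= !in_itv/= !ler_norml; first by move=> /andP[].
by move=> [-> ->].
Qed.

Lemma measurable_half_square : measurable half_square.
Proof. by rewrite half_squareE; apply: measurableX; exact: measurable_itv. Qed.

Lemma measure_half_square : sprod mu mu half_square = 1%E.
Proof.
rewrite half_squareE sprodE; [|exact: measurable_itv|exact: measurable_itv].
have muI : mu `[- 2^-1, 2^-1]%classic = 1%E.
  rewrite lebesgue_measure_itv/= lte_fin gt0_cp// -EFinB; congr EFin.
  by rewrite opprK -[2^-1]mul1r -splitr.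
by rewrite [X in (X * _)%E]muI [X in (_ * X)%E]muI mule1.
Qed.

(** For fixed [s] the substitution [p = (1 - s) w + s y] has Jacobian [s^2], which the weight [s^-2]
    cancels, and [y] in the unit square becomes [p] in the square of side [s]. Tonelli's theorem
    brings the integral in [s] outside and back. *)
Lemma integral_segment_square (G : RR * RR -> RR) (t : T) :
  measurable_fun setT G -> (forall p, 0 <= G p) ->
  (\int[sprod mu mu]_(y in half_square) \int[mu]_(s in `[0%R, 1%R])
      (G (segment_point (a t, b t) y s))%:E =
   \int[sprod mu mu]_p ((G p)%:E * \int[mu]_s (cw (t, s) p)%:E))%E.
Proof.
move=> mG G0.
set w := (a t, b t).
have mGs : measurable_fun setT (fun z : (RR * RR) * RR => G (segment_point w z.1 z.2)).
  exact: (measurableT_comp mG (measurable_segment_point w)).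
have mI : measurable (`]0, 1]%classic : set RR) by exact: measurable_itv.
have mS := measurable_half_square.
(* The scale 0, where the substitution degenerates, is removed from the range of [s] at no cost. *)
pose F (z : (RR * RR) * RR) : R :=
  \1_half_square z.1 * (\1_(`]0, 1]%classic : set RR) z.2 * G (segment_point w z.1 z.2)).
have F0 z : 0 <= F z by rewrite /F !mulr_ge0.
have mF : measurable_fun setT (fun z => (F z)%:E).
  apply/measurable_EFinP; apply: measurable_funM.
    by apply: (measurableT_comp (measurable_indic mS)).
  apply: measurable_funM => //.
  by apply: (measurableT_comp (measurable_indic mI)).
have mcw : measurable_fun setT (fun z : (RR * RR) * RR => cw (t, z.2) z.1).
  have m : measurable_fun setT (fun z : (RR * RR) * RR => ((t, z.2), z.1)).
    by apply: measurable_fun_pair => //; exact: measurable_fun_pair.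
  exact: (measurableT_comp (measurable_cone_weight ma mb) m).
transitivity (\int[sprod mu mu]_y \int[mu]_s (F (y, s))%:E)%E.
  rewrite integral_mkcond; apply: eq_integral => y _; rewrite patchE.
  case: ifPn => yS; last first.
    by rewrite integral0_eq// => s _; rewrite /F indicE (negbTE yS) mul0r.
  rewrite -integral_itv_obnd_cbnd; last first.
    apply/measurable_EFinP; apply: measurable_funTS.
    exact: (measurableT_comp mGs (pair1_measurable y)).
  rewrite integral_mkcond; apply: eq_integral => s _; rewrite patchE /F indicE yS mul1r indicE.
  by case: ifPn => _; rewrite ?mul1r ?mul0r.
rewrite (fubini_tonelli (fun z => (F z)%:E))//.
transitivity (\int[mu]_s \int[sprod mu mu]_p ((G p)%:E * (cw (t, s) p)%:E))%E; last first.
  pose K (z : (RR * RR) * RR) := ((G z.1)%:E * (cw (t, z.2) z.1)%:E)%E.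
  have K0 z : (0 <= K z)%E by rewrite mule_ge0// lee_fin// cone_weight_ge0.
  have mK : measurable_fun setT K.
    apply: emeasurable_funM; apply/measurable_EFinP => //.
    exact: (measurableT_comp mG).
  rewrite -(fubini_tonelli K mK K0).
  apply: eq_integral => p _; rewrite /K/= ge0_integralZl//.
  - apply/measurable_EFinP; exact: (measurableT_comp mcw (pair1_measurable p)).
  - by move=> s _; rewrite lee_fin cone_weight_ge0.
  - by rewrite lee_fin.
apply: eq_integral => s _.
have [/andP[s0 s1]|hs] := boolP (0 < s <= 1); last first.
  rewrite !integral0_eq// => y _.
    by rewrite /cone_weight/= andbA (negbTE hs) mule0.
  have i0 : \1_(`]0, 1]%classic : set RR) s = 0 :> R.
    by rewrite indicE memNset//= in_itv/=; exact/negP.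
  by rewrite /F/= i0 mul0r mulr0.
have mGc : measurable_fun setT (fun p => ((G p)%:E * (cw (t, s) p)%:E)%E).
  apply: emeasurable_funM; apply/measurable_EFinP => //.
  exact: (measurableT_comp mcw (pair2_measurable s)).
rewrite (ge0_integral_affine_plane ((1 - s) * a t, (1 - s) * b t) s0 mGc); last first.
  by move=> p; rewrite mule_ge0// lee_fin// cone_weight_ge0.
have mc : measurable_fun setT (fun p : RR * RR =>
    ((1 - s) * a t + s * p.1, (1 - s) * b t + s * p.2)).
  by apply: measurable_fun_pair; apply: measurable_funD => //; exact: measurable_funM.
rewrite -ge0_integralZl//; last 3 first.
- exact: (measurableT_comp mGc mc).
- by move=> p _; rewrite mule_ge0// lee_fin// cone_weight_ge0.
- by rewrite lee_fin sqr_ge0.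
apply: eq_integral => y _; rewrite /= -!EFinM; congr EFin.
have i1 : \1_(`]0, 1]%classic : set RR) s = 1 :> R.
  by rewrite indicE mem_set//= in_itv/= s0.
rewrite /F/= i1 mul1r indicE /cone_weight/= s0 s1/= !(addrC ((1 - s) * _)) !addrK !normrM gtr0_norm//.
rewrite !ler_pM2l//.
case: (boolP (_ && _)) => hy.
  rewrite mem_set// mul1r mulrCA mulfV ?mulr1 /segment_point//= ?expf_neq0 ?gt_eqF//.
  by rewrite (addrC (s * y.1)) (addrC (s * y.2)).
by rewrite memNset ?mul0r ?mulr0//=; exact/negP.
Qed.

End cone_potential.
Arguments half_square {R}.

(** * Pointwise and integral estimates for the potential *)

Section cone_potential_estimates.
Context d (T : measurableType d) (R : realType) (P : probability T R).
Local Notation mu := (@lebesgue_measure R).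
Local Notation RR := (measurableTypeR R).
Variables a b : T -> R.
Hypotheses (ma : measurable_fun setT a) (mb : measurable_fun setT b).
Hypotheses (a1 : forall t, `|a t| <= 1) (b1 : forall t, `|b t| <= 1).
Local Notation cw := (cone_weight a b).

(** The integral of [G(p) K(w, p)] with [w = (a t, b t)]. *)
Definition cone_potential (G : RR * RR -> RR) (t : T) : \bar R :=
  (\int[sprod mu mu]_p ((G p)%:E * \int[mu]_s (cw (t, s) p)%:E))%E.

Lemma half_square_disk (y : RR * RR) : half_square y -> plane_disk y.
Proof.
move=> /andP[h1 h2]; apply/unit_diskE => /=.
have sq (x : R) : `|x| <= 2^-1 -> x ^+ 2 <= 2^-1 ^+ 2.
  by move=> hx; rewrite -real_normK ?num_real// lerXn2r ?nnegrE.
rewrite -(ltr_pXn2r (n := 2))// ?nnegrE ?sqrtr_ge0// expr1n.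
rewrite sqr_sqrtr ?addr_ge0 ?sqr_ge0//.
apply: le_lt_trans (lerD (sq _ h1) (sq _ h2)) _.
by rewrite expr2 -mulrDr -[2^-1]mul1r -splitr mulr1 mul1r invf_lt1// ltr1n.
Qed.

(** The increment bound is averaged over [y] in [half_square], of measure 1, and the iterated
    integral is rewritten by [integral_segment_square]. *)
Lemma Re_le_cone_potential (g : Cplx R -> Cplx R) (rho : R) (t : T) :
  analytic_on_disk g -> plane_disk (a t, b t) ->
  (forall y, half_square y -> complex.Re (g (cpoint y)) <= rho) ->
  ((complex.Re (g (cpoint (a t, b t))))%:E <=
    rho%:E + 2%:E * cone_potential (disk_gradient g) t)%E.
Proof.
move=> ag Dt hrho.
set v := complex.Re _.
have mG := measurable_disk_gradient ag.
have G0 := disk_gradient_ge0 g.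
(* When [v <= rho] nonnegativity of the potential suffices. Otherwise [v - rho] is positive, as the
   comparison of nonnegative integrals requires. *)
have [vrho|rhov] := leP v rho.
  apply: (@le_trans _ _ rho%:E); first by rewrite lee_fin.
  rewrite leeDl// mule_ge0// integral_ge0// => p _.
  by rewrite mule_ge0 ?lee_fin//= integral_ge0// => s _; rewrite lee_fin cone_weight_ge0.
rewrite -leeBlDl// -EFinB.
have mS : measurable half_square := measurable_half_square (R := R).
have mGs : measurable_fun setT (fun z : (RR * RR) * RR =>
    disk_gradient g (segment_point (a t, b t) z.1 z.2)).
  exact: (measurableT_comp mG (measurable_segment_point _)).
have mI : measurable (`[0, 1]%classic : set RR) by exact: measurable_itv.
rewrite /cone_potential -(integral_segment_square ma mb)//.
have mK : measurable_fun setT (fun y : RR * RR =>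
    \int[mu]_(s in `[0%R, 1%R]) (disk_gradient g (segment_point (a t, b t) y s))%:E)%E.
  have mF : measurable_fun setT (fun z : (RR * RR) * RR =>
      (\1_(`[0, 1]%classic : set RR) z.2 * disk_gradient g (segment_point (a t, b t) z.1 z.2))%:E).
    apply/measurable_EFinP; apply: measurable_funM => //.
    exact: (measurableT_comp (measurable_indic mI)).
  rewrite [X in measurable_fun _ X](_ : _ = fun y => (\int[mu]_s
      (\1_(`[0, 1]%classic : set RR) s * disk_gradient g (segment_point (a t, b t) y s))%:E)%E).
    apply: (measurable_fun_fubini_tonelli_F _ mF) => z.
    by rewrite lee_fin mulr_ge0.
  apply/funext => y; rewrite integral_mkcond; apply: eq_integral => s _.
  by rewrite patchE indicE; case: ifPn => _; rewrite ?mul1r ?mul0r.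
rewrite -ge0_integralZl//; last 2 first.
- exact: measurable_funTS.
- by move=> y _; apply: integral_ge0 => s _; rewrite lee_fin.
have -> : ((v - rho)%:E = \int[sprod mu mu]_(y in half_square) (v - rho)%:E)%E.
  by rewrite integral_cst// [X in (_ * X)%E]measure_half_square mule1.
apply: ge0_le_integral => //.
- by move=> y _; rewrite lee_fin subr_ge0 ltW.
- by apply: measurable_funTS; apply: measurable_funeM.
move=> y Sy.
have Dy := half_square_disk Sy.
apply: (@le_trans _ _ (v - complex.Re (g (cpoint y)))%:E).
  by rewrite lee_fin lerB// hrho.
apply: (le_trans (Re_increment_le ag Dt Dy)).
under eq_integral do rewrite EFinM.
rewrite ge0_integralZl//.
- apply/measurable_EFinP; apply: measurable_funTS.
  exact: (measurableT_comp mGs (pair1_measurable y)).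
- by move=> s _; rewrite lee_fin.
Qed.

Lemma measurable_cone_potential (G : RR * RR -> RR) :
  measurable_fun setT G -> (forall p, 0 <= G p) ->
  measurable_fun setT (cone_potential G).
Proof.
move=> mG G0.
have mW : measurable_fun setT (fun z : (T * RR) * (RR * RR) => (cw z.1 z.2)%:E).
  by apply/measurable_EFinP; exact: measurable_cone_weight.
have m : measurable_fun setT (fun z : (T * (RR * RR)) * RR => ((z.1.1, z.2), z.1.2)).
  apply: measurable_fun_pair; first apply: measurable_fun_pair => //;
    exact: measurableT_comp.
have mh : measurable_fun setT (fun z : T * (RR * RR) =>
    \int[mu]_s (cw (z.1, s) z.2)%:E)%E.
  apply: (measurable_fun_fubini_tonelli_F _ (measurableT_comp mW m)) => z.
  by rewrite lee_fin cone_weight_ge0.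
have mGh : measurable_fun setT (fun z : T * (RR * RR) =>
    ((G z.2)%:E * \int[mu]_s (cw (z.1, s) z.2)%:E)%E).
  apply: emeasurable_funM => //; apply/measurable_EFinP; exact: measurableT_comp.
apply: (measurable_fun_fubini_tonelli_F _ mGh) => z.
rewrite mule_ge0 ?lee_fin// integral_ge0// => s _.
by rewrite lee_fin cone_weight_ge0.
Qed.

(** Tonelli's theorem puts the integral in [t] on the weights, then [2 G H <= G^2 / tau + tau H^2]
    is integrated. The free parameter [tau] replaces the Cauchy-Schwarz inequality and is chosen at
    the very end. *)
Lemma integral_cone_potential_le (G : RR * RR -> RR) (tau : R) : 0 < tau ->
  measurable_fun setT G -> (forall p, 0 <= G p) ->
  (\int[P]_t (2%:E * cone_potential G t) <=
   (tau^-1)%:E * \int[sprod mu mu]_p (G p ^+ 2)%:E +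
   tau%:E * \int[sprod mu mu]_p ((\int[sprod P mu]_x (cw x p)%:E) *
                                 (\int[sprod P mu]_x (cw x p)%:E)))%E.
Proof.
move=> tau0 mG G0.
have mW : measurable_fun setT (fun z : (T * RR) * (RR * RR) => (cw z.1 z.2)%:E).
  by apply/measurable_EFinP; exact: measurable_cone_weight.
have W0 x p : (0 <= (cw x p)%:E)%E by rewrite lee_fin cone_weight_ge0.
pose H p := (\int[sprod P mu]_x (cw x p)%:E)%E.
have H0 p : (0 <= H p)%E by exact: integral_ge0.
have mH : measurable_fun setT H.
  exact: (measurable_fun_fubini_tonelli_G (fun z => (cw z.1 z.2)%:E)).
pose h (z : T * (RR * RR)) := (\int[mu]_s (cw (z.1, s) z.2)%:E)%E.
have h0 z : (0 <= h z)%E by exact: integral_ge0.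
have mh : measurable_fun setT h.
  have m : measurable_fun setT (fun z : (T * (RR * RR)) * RR => ((z.1.1, z.2), z.1.2)).
    apply: measurable_fun_pair; first apply: measurable_fun_pair => //;
      exact: measurableT_comp.
  by apply: (measurable_fun_fubini_tonelli_F _ (measurableT_comp mW m)) => z; exact: W0.
have mGh : measurable_fun setT (fun z : T * (RR * RR) => ((G z.2)%:E * h z)%E).
  apply: emeasurable_funM => //; apply/measurable_EFinP; exact: measurableT_comp.
have Gh0 z : (0 <= (G z.2)%:E * h z)%E by rewrite mule_ge0// lee_fin.
have mGE : measurable_fun setT (fun p => (G p)%:E) by exact/measurable_EFinP.
rewrite ge0_integralZl//; last 2 first.
- exact: measurable_cone_potential.
- by move=> t _; apply: integral_ge0 => p _; exact: (Gh0 (t, p)).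
have -> : (\int[P]_t cone_potential G t = \int[sprod mu mu]_p ((G p)%:E * H p))%E.
  rewrite /cone_potential (fubini_tonelli (fun z => ((G z.2)%:E * h z)%E))//.
  apply: eq_integral => p _ /=.
  rewrite ge0_integralZl//; last 2 first.
  - exact: (measurableT_comp mh (pair2_measurable p)).
  - by rewrite lee_fin.
  congr (_ * _)%E; rewrite /H integral_sprod//.
  exact: (measurableT_comp mW (pair2_measurable p)).
have mG2 : measurable_fun setT (fun p => (G p ^+ 2)%:E).
  by apply/measurable_EFinP; exact: measurable_funX.
have mHH : measurable_fun setT (fun p => (H p * H p)%E) by exact: emeasurable_funM.
have mGH : measurable_fun setT (fun p => ((G p)%:E * H p)%E) by exact: emeasurable_funM.
rewrite -ge0_integralZl//; last by move=> p _; rewrite mule_ge0// lee_fin.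
rewrite -ge0_integralZl//; last 2 first.
- by move=> p _; rewrite lee_fin sqr_ge0.
- by rewrite lee_fin invr_ge0 ltW.
rewrite -[X in (_ + X)%E]ge0_integralZl//; last 2 first.
- by move=> p _; exact: mule_ge0 (H0 p) (H0 p).
- by rewrite lee_fin ltW.
rewrite -ge0_integralD//; last 4 first.
- by move=> p _; rewrite mule_ge0 ?lee_fin ?sqr_ge0// invr_ge0 ltW.
- exact: measurable_funeM.
- by move=> p _; apply: mule_ge0; [rewrite lee_fin ltW|exact: mule_ge0 (H0 p) (H0 p)].
- exact: measurable_funeM.
apply: ge0_le_integral => //.
- by move=> p _; rewrite !mule_ge0// lee_fin.
- exact: measurable_funeM.
- by apply: emeasurable_funD; exact: measurable_funeM.
move=> p _.
(* The function [H] may be infinite at some points; there the right-hand side is infinite too. *)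
rewrite -/(H p); case: (H p) (H0 p) => [r| |]//.
  rewrite lee_fin => r0; rewrite -!EFinM -EFinD lee_fin -subr_ge0.
  have -> : tau^-1 * G p ^+ 2 + tau * (r * r) - 2 * (G p * r) =
      tau^-1 * (G p - tau * r) ^+ 2 by field; rewrite gt_eqF.
  by rewrite mulr_ge0 ?sqr_ge0// invr_ge0 ltW.
move=> _; have -> : (tau%:E * (+oo * +oo) = +oo :> \bar R)%E.
  by rewrite mulyy gt0_muley// lte_fin.
by rewrite addey ?leey// -EFinM.
Qed.

End cone_potential_estimates.

(** * The test polynomials *)

Section harmonic.
Context {R : realType}.

Definition harmonic_sum (N : nat) : R := \sum_(k < N) k.+1%:R^-1.

(** Each dyadic block of the harmonic series contributes at least one half. *)
Lemma harmonic_sum_ge (n : nat) : n%:R / 2 <= harmonic_sum (2 ^ n).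
Proof.
elim: n => [|n IH]; first by rewrite mul0r /harmonic_sum sumr_ge0.
rewrite -natr1 mulrDl mul1r expnS mul2n -addnn /harmonic_sum big_split_ord/=.
apply: lerD => //.
apply: (@le_trans _ _ (\sum_(i < 2 ^ n) (2 ^ n.+1)%:R^-1)).
  rewrite sumr_const card_ord -[leRHS]mulr_natl (expnS 2 n) natrM.
  by rewrite invfM mulrCA mulfV ?mulr1// pnatr_eq0 expn_eq0.
apply: ler_sum => i _; rewrite lef_pV2 ?posrE ?ltr0n ?expn_gt0// ler_nat.
by rewrite expnS mul2n -addnn -addnS leq_add2l.
Qed.

(** Here [v] stands for the squared modulus of the derivative of the test polynomial and [rho] for
    the distance to [xi]. If [rho] is within the last threshold, the last term alone dominates [v];
    otherwise the decay [v * rho ^+ 2 <= 4] gives the size bound needed one level below. *)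
Lemma dyadic_sum_ge (n : nat) (v rho : R) :
  0 <= v -> 0 <= rho <= 2 -> v * rho ^+ 2 <= 4 -> v <= 4 * 4 ^+ n ->
  v <= \sum_(j < n.+1) 4 ^+ j.+1 * (rho <= 2 / 2 ^+ j)%R%:R.
Proof.
move=> v0 /andP[r0 r2] vr; elim: n => [|n IH] vn.
  by rewrite big_ord1 expr0 divr1 r2 mulr1 expr1 (le_trans vn)// expr0 mulr1.
rewrite big_ord_recr/=.
have [hr|hr] := leP rho (2 / 2 ^+ n.+1).
  rewrite mulr1 -[leLHS]add0r; apply: lerD; last by rewrite exprS.
  by apply: sumr_ge0 => i _; rewrite mulr_ge0// exprn_ge0.
rewrite mulr0 addr0; apply: IH.
have p0 : 0 < (2 : R) ^+ n by rewrite exprn_gt0.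
have hr2 : (2 ^+ n)^-1 <= rho.
  by apply: le_trans (ltW hr); rewrite exprS invfM mulrA mulfV// mul1r.
have hr3 : (4 ^+ n)^-1 <= rho ^+ 2.
  have -> : (4 : R) ^+ n = (2 ^+ n) ^+ 2 by rewrite (_ : 4 = 2 ^+ 2); [rewrite -!exprM mulnC|ring].
  by rewrite -exprVn lerXn2r ?nnegrE// invr_ge0 ltW.
have p4 : 0 < (4 : R) ^+ n by rewrite exprn_gt0.
rewrite -ler_pdivrMr//; apply: le_trans vr.
exact: ler_wpM2l.
Qed.

End harmonic.

Section log_polynomial.
Context {R : realType}.
Local Notation mu := (@lebesgue_measure R).
Local Notation RR := (measurableTypeR R).
Local Open Scope complex_scope.
Implicit Types (z w xi : Cplx R).

(** The Taylor polynomial of degree [N] of [- log (1 - xi^* z)], whose full series is singular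
    exactly at [xi]. *)
Definition log_poly xi (N : nat) : {poly R[i]} :=
  \sum_(k < N) ((xi^* ^+ k.+1) / k.+1%:R) *: 'X^(k.+1).

Lemma horner_log_poly xi N z :
  (log_poly xi N).[z] = \sum_(k < N) ((k.+1%:R^-1 : R)%:C : R[i]) * (xi^* * z) ^+ k.+1.
Proof.
rewrite /log_poly horner_sum; apply: eq_bigr => k _.
by rewrite hornerZ hornerXn exprMn fmorphV rmorph_nat mulrAC mulrC.
Qed.

Lemma is_derive_horner (p : {poly R[i]}) z :
  is_derive z (1 : Cplx R) (fun x : Cplx R => p.[x] : Cplx R) p^`().[z].
Proof.
elim/poly_ind: p => [|p c IH].
  rewrite deriv0 horner0; have -> : (fun x : Cplx R => 0.[x] : Cplx R) = cst 0.
    by apply/funext => x /=; rewrite horner0.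
  exact: is_derive_cst.
have -> : (fun x : Cplx R => (p * 'X + c%:P).[x] : Cplx R) =
    (fun x : Cplx R => p.[x] : Cplx R) * id + cst c.
  by apply/funext => x /=; rewrite !hornerE.
have h := is_deriveD (is_deriveM IH (is_derive_id z 1)) (is_derive_cst (c : Cplx R) z 1).
apply: (is_derive_eq h).
by rewrite derivMXaddC !hornerE /GRing.scale/= ?addr0 mulr1 [z * _]mulrC.
Qed.

Lemma derivable_log_poly xi N z : derivable (horner (log_poly xi N) : Cplx R -> Cplx R) z 1.
Proof. by have [] := is_derive_horner (log_poly xi N) z. Qed.

Lemma derive1_log_poly xi N z :
  derive1 (horner (log_poly xi N) : Cplx R -> Cplx R) z =
  \sum_(k < N) xi^* * (xi^* * z) ^+ k.
Proof.
have [_ h] := is_derive_horner (log_poly xi N) z; rewrite derive1E h.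
rewrite /log_poly raddf_sum horner_sum; apply: eq_bigr => k _ /=.
rewrite derivZ derivXn hornerZ hornerMn hornerXn/=.
rewrite -[X in _ * X]mulr_natl mulrA divfK ?pnatr_eq0// exprS exprMn mulrA.
by [].
Qed.

Lemma normc_conj z : Normc.normc z^* = Normc.normc z.
Proof. by case: z => a b; rewrite /= sqrrN. Qed.

Lemma normcX z n : Normc.normc (z ^+ n) = Normc.normc z ^+ n.
Proof.
elim: n => [|n IH]; first by rewrite !expr0 Normc.normc1.
by rewrite !exprS Normc.normcM IH.
Qed.

Lemma normc_sum (N : nat) (F : 'I_N -> Cplx R) :
  Normc.normc (\sum_(k < N) F k) <= \sum_(k < N) Normc.normc (F k).
Proof.
elim/big_ind2 : _ => //; first by rewrite Normc.normc0.
by move=> x1 x2 y1 y2 h1 h2; rewrite (le_trans (normcD_le _ _))// lerD.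
Qed.

(** Comparison with the geometric series. The bound does not depend on [N], which makes the
    contribution of the central square harmless. *)
Lemma log_poly_bound xi N z (rho : R) : Normc.normc xi = 1 -> Normc.normc z <= rho ->
  rho < 1 -> Normc.normc (log_poly xi N).[z] <= (1 - rho)^-1.
Proof.
move=> xi1 zrho rho1; have rho0 := le_trans (normc_ge0 z) zrho.
rewrite horner_log_poly; apply: (le_trans (normc_sum _)).
apply: (@le_trans _ _ (\sum_(k < N) rho ^+ k)).
  apply: ler_sum => k _.
  rewrite Normc.normcM normc_real normcX Normc.normcM normc_conj xi1 mul1r.
  rewrite ger0_norm ?invr_ge0//.
  apply: (@le_trans _ _ (1 * rho ^+ k.+1)).
    apply: ler_pM; rewrite ?invr_ge0 ?exprn_ge0 ?normc_ge0//.
      by rewrite invf_le1// ler1n.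
    by rewrite lerXn2r ?nnegrE ?normc_ge0.
  by rewrite mul1r exprS ler_piMl ?exprn_ge0// ltW.
have h : (1 - rho) * \sum_(k < N) rho ^+ k = 1 - rho ^+ N.
  by rewrite -[1 - rho]opprB mulNr -subrX1 opprB.
have p : 0 < 1 - rho by rewrite subr_gt0.
by rewrite -(ler_pM2l p) h mulfV ?gt_eqF// gerBl exprn_ge0.
Qed.

(** This depends on [N] but holds up to the circle; it will serve as the dominating constant. *)
Lemma log_poly_le_harmonic xi N z : Normc.normc xi = 1 -> Normc.normc z <= 1 ->
  Normc.normc (log_poly xi N).[z] <= harmonic_sum N.
Proof.
move=> xi1 z1; rewrite horner_log_poly; apply: (le_trans (normc_sum _)).
apply: ler_sum => k _.
rewrite Normc.normcM normc_real normcX Normc.normcM normc_conj xi1 mul1r.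
rewrite ger0_norm ?invr_ge0// ler_piMr ?invr_ge0//.
by rewrite exprn_ile1 ?normc_ge0.
Qed.

Lemma log_poly_at xi N : Normc.normc xi = 1 ->
  (log_poly xi N).[xi] = (harmonic_sum N)%:C.
Proof.
move=> xi1; rewrite horner_log_poly rmorph_sum; apply: eq_bigr => k _.
have -> : xi^* * xi = 1.
  by rewrite mulrC -sqr_normc normr_normc xi1 expr1n.
by rewrite expr1n mulr1.
Qed.

Lemma log_poly_deriv_le xi N z : Normc.normc xi = 1 -> Normc.normc z <= 1 ->
  Normc.normc (derive1 (horner (log_poly xi N) : Cplx R -> Cplx R) z) <= N%:R.
Proof.
move=> xi1 z1; rewrite derive1_log_poly; apply: (le_trans (normc_sum _)).
apply: (@le_trans _ _ (\sum_(k < N) 1)); last by rewrite sumr_const card_ord.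
apply: ler_sum => k _.
rewrite Normc.normcM normcX Normc.normcM normc_conj xi1 !mul1r.
by rewrite exprn_ile1 ?normc_ge0.
Qed.

(** The derivative is a geometric sum, and multiplication by [z - xi] telescopes it to
    [(xi^* z)^N - 1]. *)
Lemma log_poly_deriv_dist_le xi N z : Normc.normc xi = 1 -> Normc.normc z <= 1 ->
  Normc.normc (derive1 (horner (log_poly xi N) : Cplx R -> Cplx R) z) *
    Normc.normc (z - xi) <= 2.
Proof.
move=> xi1 z1; rewrite derive1_log_poly -big_distrr/= -Normc.normcM.
have xixi : xi^* * xi = 1.
  by rewrite mulrC -sqr_normc normr_normc xi1 expr1n.
have -> : xi^* * (\sum_(i < N) (xi^* * z) ^+ i) * (z - xi) = (xi^* * z) ^+ N - 1.
  by rewrite subrX1 mulrAC mulrBr xixi.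
rewrite (le_trans (normcD_le _ _))// normcN Normc.normc1 normcX.
rewrite Normc.normcM normc_conj xi1 mul1r -[2]/(1 + 1) lerD2r.
by rewrite exprn_ile1 ?normc_ge0.
Qed.

End log_polynomial.

(** * Dirichlet integrals of the test polynomials and of their compositions *)

Section dirichlet_integral.
Context {R : realType}.
Local Notation mu := (@lebesgue_measure R).
Local Notation RR := (measurableTypeR R).
Implicit Types (f g phi : Cplx R -> Cplx R) (xi : Cplx R).

(** The Dirichlet integral without the factor [pi^-1], as an integral over the whole plane. *)
Definition gradient_energy g : \bar R :=
  (\int[sprod mu mu]_p (disk_gradient g p ^+ 2)%:E)%E.

Lemma gradient_energy_ge0 g : (0 <= gradient_energy g)%E.
Proof. by apply: integral_ge0 => p _; rewrite lee_fin sqr_ge0. Qed.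

Lemma dirichlet_integralE g : dirichlet_integral g = ((pi^-1)%:E * gradient_energy g)%E.
Proof.
congr (_ * _)%E; rewrite integral_mkcond; apply: eq_integral => p _.
by rewrite /disk_gradient !patchE; case: ifP => // _; rewrite expr0n.
Qed.

Lemma gradient_energyE g : gradient_energy g = (pi%:E * dirichlet_integral g)%E.
Proof.
rewrite dirichlet_integralE muleA -EFinM mulfV ?mul1e// gt_eqF// pi_gt0.
by [].
Qed.

(** By [dyadic_sum_ge] the squared derivative is at most the sum of [4 ^+ j.+1] times the indicators
    of squares [Q j] around [xi]. Since [Q j] has area [16 / 4 ^+ j], each of the [n.+1] scales
    contributes 64: the growth is logarithmic in the degree [2 ^ n]. *)
Lemma gradient_energy_log_poly xi (n : nat) : Normc.normc xi = 1 ->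
  (gradient_energy (horner (log_poly xi (2 ^ n))) <= (64 * n.+1%:R)%:E)%E.
Proof.
move=> xi1; set f : Cplx R -> Cplx R := horner _.
have ag : analytic_on_disk f by move=> z _; exact: derivable_log_poly.
pose I (c : R) (j : nat) : set RR := `[c - 2 / 2 ^+ j, c + 2 / 2 ^+ j]%classic.
pose Q j : set (RR * RR) := I (complex.Re xi) j `*` I (complex.Im xi) j.
have mI c j : measurable (I c j) by exact: measurable_itv.
have mQ j : measurable (Q j) by exact: measurableX.
have p2 j : 0 < (2 : R) ^+ j by rewrite exprn_gt0.
have muI c j : mu (I c j) = (4 / 2 ^+ j)%:E.
  rewrite /I lebesgue_measure_itv/= lte_fin ltrD2l gt0_cp ?divr_gt0// -EFinB.
  by congr EFin; field; rewrite gt_eqF.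
have muQ j : sprod mu mu (Q j) = (16 / 4 ^+ j)%:E.
  rewrite sprodE// [X in (X * _)%E]muI [X in (_ * X)%E]muI -EFinM; congr EFin.
  rewrite mulrACA -invfM -exprMn -!natrM.
  by [].
apply: (@le_trans _ _ (\int[sprod mu mu]_p
    (\sum_(j < n.+1) (4 ^+ j.+1 * \1_(Q j) p)%:E)%E)%E).
  apply: ge0_le_integral => //.
  - by move=> p _; rewrite lee_fin sqr_ge0.
  - by apply/measurable_EFinP; apply: measurable_funX; exact: measurable_disk_gradient.
  - apply: emeasurable_sum => j; apply/measurable_EFinP; apply: measurable_funM => //.
  move=> p _; rewrite sumEFin lee_fin /disk_gradient patchE.
  case: ifPn => [/set_mem Dp|_]; last first.
    by rewrite expr0n/= sumr_ge0// => j _; rewrite mulr_ge0// exprn_ge0.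
  set v := Normc.normc _.
  have v0 : 0 <= v by exact: normc_ge0.
  have z1 : Normc.normc (cpoint p) <= 1 by apply: ltW; exact/unit_diskE.
  pose rho := Normc.normc (cpoint p - xi).
  have rho0 : 0 <= rho by exact: normc_ge0.
  have rho2 : rho <= 2.
    by rewrite (le_trans (normcD_le _ _))// normcN xi1 -[2]/(1 + 1) lerD2r.
  have vrho : v * rho <= 2 by exact: log_poly_deriv_dist_le.
  have vn : v <= 2 ^+ n by rewrite -natrX; exact: log_poly_deriv_le.
  apply: (@le_trans _ _ (\sum_(j < n.+1) 4 ^+ j.+1 * (rho <= 2 / 2 ^+ j)%R%:R)).
    apply: dyadic_sum_ge; rewrite ?sqr_ge0 ?rho0//.
      have -> : (4 : R) = 2 ^+ 2 by ring.
      by rewrite -exprMn lerXn2r ?nnegrE ?mulr_ge0.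
    apply: (@le_trans _ _ (4 ^+ n)); last by rewrite ler_peMl ?exprn_ge0// ler1n.
    have -> : (4 : R) ^+ n = (2 ^+ n) ^+ 2.
      by rewrite (_ : 4 = 2 ^+ 2); [rewrite -!exprM mulnC|ring].
    by rewrite lerXn2r ?nnegrE// ltW.
  apply: ler_sum => j _; rewrite ler_wpM2l ?exprn_ge0// indicE.
  case: (leP rho) => // hr; rewrite mem_set//.
  have h1 := le_trans (Re_le_normc (cpoint p - xi)) hr.
  have h2 := le_trans (Im_le_normc (cpoint p - xi)) hr.
  move: h1 h2; rewrite !raddfB /cpoint/= !ler_distl => h1 h2.
  by split; rewrite /I /= in_itv.
rewrite ge0_integral_sum//; last first.
  by move=> j; apply/measurable_EFinP; apply: measurable_funM.
rewrite (eq_bigr (fun=> 64%:E)); last first.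
  move=> j _; under eq_integral do rewrite EFinM.
  rewrite ge0_integralZl//; last first.
    by apply/measurable_EFinP; exact: measurable_indic.
  rewrite integral_indic// setIT [X in (_ * X)%E]muQ -EFinM; congr EFin.
  have : (4 : R) ^+ j != 0 by rewrite expf_neq0.
  by rewrite exprS => h; field.
by rewrite sumEFin lee_fin sumr_const card_ord mulr_natr.
Qed.

Lemma log_poly_dirichlet xi (n : nat) : Normc.normc xi = 1 ->
  dirichlet_space (horner (log_poly xi (2 ^ n)) : Cplx R -> Cplx R).
Proof.
move=> xi1; split.
- by move=> z _; exact: derivable_log_poly.
- by rewrite horner_log_poly big1// => k _; rewrite mulr0 expr0n mulr0.
- rewrite dirichlet_integralE.
  apply: (@le_lt_trans _ _ ((pi^-1)%:E * (64 * n.+1%:R)%:E)%E).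
    apply: lee_wpmul2l; first by rewrite lee_fin invr_ge0 pi_ge0.
    exact: gradient_energy_log_poly.
  by rewrite -EFinM ltry.
Qed.

(** The norm inequality is squared, which is legitimate for any sign of [M] because the left-hand
    norm is nonnegative. Finiteness of both integrals makes [fine] faithful. *)
Lemma gradient_energy_composition phi f (M : R) :
  dirichlet_space f -> dirichlet_space (f \o phi) ->
  dirichlet_norm (f \o phi) <= M * dirichlet_norm f ->
  (gradient_energy (f \o phi) <= (M ^+ 2)%:E * gradient_energy f)%E.
Proof.
move=> [_ _ ff] [_ _ fg] hM; rewrite !gradient_energyE.
have D0 (g : Cplx R -> Cplx R) : (0 <= dirichlet_integral g)%E.
  by rewrite dirichlet_integralE mule_ge0 ?gradient_energy_ge0// lee_fin invr_ge0 pi_ge0.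
have fin (g : Cplx R -> Cplx R) : (dirichlet_integral g < +oo)%E ->
    dirichlet_integral g = (dirichlet_norm g ^+ 2)%:E.
  move=> gfin; rewrite /dirichlet_norm sqr_sqrtr ?fine_ge0// fineK//.
  by rewrite ge0_fin_numE.
have Ef := fin _ ff; have Eg := fin _ fg.
rewrite {}Eg {}Ef.
have n0 : 0 <= dirichlet_norm (f \o phi) by exact: sqrtr_ge0.
move: (dirichlet_norm f) (dirichlet_norm (f \o phi)) n0 hM => x y y0 hM.
rewrite muleCA.
apply: lee_wpmul2l; first by rewrite lee_fin pi_ge0.
rewrite -EFinM lee_fin.
by rewrite -exprMn lerXn2r ?nnegrE// (le_trans y0).
Qed.

End dirichlet_integral.

(** * Probability measures on the circle *)

Section borel_plane.
Context {R : realType}.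
Local Notation RR := (measurableTypeR R).
Local Notation T := (borelC R).

Lemma borelC_open (U : set (Cplx R)) : open U -> measurable (U : set T).
Proof. by move=> oU; apply: sub_sigma_algebra. Qed.

Lemma open_normcP (U : set (Cplx R)) :
  (forall z, U z -> exists2 d : R, 0 < d & forall w, Normc.normc (w - z) < d -> U w) ->
  open U.
Proof. by move=> hU; rewrite openE => z Uz; apply/nbhs_normcP; exact: hU. Qed.

Lemma measurable_borelC_lipschitz (u : Cplx R -> R) :
  (forall z w, `|u w - u z| <= Normc.normc (w - z)) ->
  measurable_fun setT (u : T -> RR).
Proof.
move=> hu; apply: (measurability _ (RGenOInfty.measurableE R)).
move=> _ [_ [x ->] <-]; rewrite setTI; apply: borelC_open; apply: open_normcP => z /=.
rewrite in_itv/= andbT => xz; exists (u z - x); first by rewrite subr_gt0.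
move=> w /(le_lt_trans (hu z w)); rewrite /= in_itv/= andbT.
by rewrite ltr_distl opprB addrCA subrr addr0 => /andP[].
Qed.

Lemma measurable_Re : measurable_fun setT (@complex.Re R : T -> RR).
Proof.
apply: measurable_borelC_lipschitz => z w.
by rewrite -raddfB; exact: Re_le_normc.
Qed.

Lemma measurable_Im : measurable_fun setT (@complex.Im R : T -> RR).
Proof.
apply: measurable_borelC_lipschitz => z w.
by rewrite -raddfB; exact: Im_le_normc.
Qed.

(** The modulus is written through real and imaginary parts of each variable, which are measurable
    for the product sigma-algebra. *)
Lemma measurable_normcB :
  measurable_fun setT (fun z : T * T => Normc.normc ((z.1 : Cplx R) - z.2) : RR).
Proof.
have m1 : measurable_fun setT (fun z : T * T => complex.Re (z.1 : Cplx R) : RR).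
  exact: measurableT_comp measurable_Re (@measurable_fst _ _ T T).
have m2 : measurable_fun setT (fun z : T * T => complex.Re (z.2 : Cplx R) : RR).
  exact: measurableT_comp measurable_Re (@measurable_snd _ _ T T).
have m3 : measurable_fun setT (fun z : T * T => complex.Im (z.1 : Cplx R) : RR).
  exact: measurableT_comp measurable_Im (@measurable_fst _ _ T T).
have m4 : measurable_fun setT (fun z : T * T => complex.Im (z.2 : Cplx R) : RR).
  exact: measurableT_comp measurable_Im (@measurable_snd _ _ T T).
have msqrt : measurable_fun setT (@Num.sqrt R).
  exact: (continuous_measurable_fun (@sqrt_continuous R)).
have m : measurable_fun setT (fun z : T * T =>
   (complex.Re (z.1 : Cplx R) - complex.Re (z.2 : Cplx R)) ^+ 2 +
   (complex.Im (z.1 : Cplx R) - complex.Im (z.2 : Cplx R)) ^+ 2 : RR).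
  exact: (measurable_funD (measurable_funX 2 (measurable_funB m1 m2))
    (measurable_funX 2 (measurable_funB m3 m4))).
apply: (eq_measurable_fun _ _ (measurableT_comp msqrt m)).
by move=> -[[x y] [x' y']] _.
Qed.

Lemma measurable_unit_circle : measurable (@unit_circle R : set T).
Proof.
have m : measurable_fun setT (@Normc.normc R : T -> RR).
  apply: measurable_borelC_lipschitz => z w; exact: normcB_ge.
have -> : @unit_circle R = (@Normc.normc R : T -> RR) @^-1` [set 1].
  by apply/seteqP; split=> z /unit_circleE.
rewrite -[X in measurable X]setTI; apply: m => //; exact: measurable_set1.
Qed.

Lemma measurable_log_kernel : measurable_fun setT (fun z : T * T => log_kernel z.1 z.2).
Proof.
have mN := measurable_normcB.
rewrite (_ : (fun z : T * T => _) = fun z : T * T =>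
   if Normc.normc ((z.1 : Cplx R) - z.2) == 0 then +oo%E
   else (ln (expR 1 / Normc.normc ((z.1 : Cplx R) - z.2)))%:E); last first.
  apply/funext => z; rewrite /log_kernel.
  have [->|zw] := eqVneq (z.1 : Cplx R) z.2; first by rewrite subrr Normc.normc0 eqxx.
  by case: eqP => // /Normc.eq0_normc/eqP; rewrite subr_eq0 (negbTE zw).
apply: measurable_fun_ifT.
- exact: measurable_fun_eqr.
- exact: measurable_cst.
- apply/measurable_EFinP; apply: (measurableT_comp (@measurable_ln R)).
  by apply: measurable_funM => //; exact: measurable_funV.
Qed.

(** A point outside the support has a null open neighbourhood, hence lies in a null square with
    rational data; there are countably many such squares. *)
Lemma support_complement_negligible (m : probability T R) :
  m.-negligible (~` (measure_support m : set T)).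
Proof.
pose sq (a b d : R) : set T :=
  [set z : Cplx R | `|complex.Re z - a| < d /\ `|complex.Im z - b| < d].
have osq a b d : open (sq a b d : set (Cplx R)).
  apply: open_normcP => z [za zb].
  exists (Num.min (d - `|complex.Re z - a|) (d - `|complex.Im z - b|)).
    by rewrite lt_min !subr_gt0 za zb.
  move=> w; rewrite lt_min => /andP[wa wb].
  have h1 := le_lt_trans (Re_le_normc (w - z)) wa.
  have h2 := le_lt_trans (Im_le_normc (w - z)) wb.
  move: h1 h2; rewrite !raddfB/= !ltrBrDr => h1 h2; split.
    by apply: le_lt_trans h1; exact: ler_distD.
  by apply: le_lt_trans h2; exact: ler_distD.
pose W (x : rat * rat * nat) : set T :=
  let S := sq (ratr x.1.1) (ratr x.1.2) x.2.+1%:R^-1 in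
  if (m S == 0)%E then S else set0.
pose V (k : nat) : set T := oapp W set0 (unpickle k).
have VE x : V (pickle x) = W x by rewrite /V pickleK.
apply: (@negligibleS _ _ _ _ (\bigcup_k V k)); last first.
  apply: negligible_bigcup => k; rewrite /V.
  case: (unpickle k) => [[[a b] n]|]; last exact: negligible_set0.
  rewrite /oapp /W; case: eqP => [h|_]; last exact: negligible_set0.
  by exists (sq (ratr a) (ratr b) n.+1%:R^-1); split => //; exact: borelC_open.
move=> z /existsNP[U /not_implyP[oU /not_implyP[Uz mU]]].
have [d d0 hd] : exists2 d : R, 0 < d & forall w, Normc.normc (w - z) < d -> U w.
  by apply/nbhs_normcP; exact: open_nbhs_nbhs.
(* Two points of a square of half-side below [d / 4] differ by less than [d / 2] in each coordinate,
   and [normc_le_max] loses another factor 2. *)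
have d40 : 0 < d / 4 by rewrite divr_gt0.
have [n hn] : exists n : nat, n.+1%:R^-1 < d / 4.
  have [n _ hn] := near_infty_natSinv_lt (PosNum d40).
  by exists n; exact: hn (leqnn n).
set e : R := n.+1%:R^-1 in hn.
have e0 : 0 < e by rewrite invr_gt0.
have rat_near (x : R) : exists a : rat, `|x - ratr a| < e.
  have [|a] := @rat_in_itvoo R (x - e) (x + e); first by rewrite ltrD2l gt0_cp.
  by rewrite in_itv/= => h; exists a; rewrite distrC ltr_distl.
have [a ha] := rat_near (complex.Re z); have [b hb] := rat_near (complex.Im z).
exists (pickle (a, b, n)); first exact: I.
rewrite VE /W [_.1.1]/= [_.1.2]/= [_.2]/= -/e.
have -> : (m (sq (ratr a) (ratr b) e) == 0)%E; last by split.
have mU0 : m U = 0%E.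
  by apply/eqP; rewrite eq_le measure_ge0 andbT leNgt; exact/negP.
rewrite eq_le measure_ge0 andbT -mU0; apply: le_measure.
- by apply: mem_set; exact: borelC_open.
- by apply: mem_set; exact: borelC_open.
move=> w [wa wb]; apply: hd; apply: le_lt_trans (normc_le_max _) _.
have near2 (x y c : R) : `|x - c| < e -> `|y - c| < e -> `|y - x| < d / 2.
  move=> hx hy; apply: le_lt_trans (ler_distD c _ _) _.
  rewrite (distrC c x); apply: lt_le_trans (ltrD hy hx) _.
  by move: hn; rewrite ltr_pdivlMr// => hn; rewrite ler_pdivlMr//; lra.
rewrite [ltRHS](_ : d = 2 * (d / 2)); last by field.
rewrite ltr_pM2l// gt_max !raddfB/=.
by rewrite (near2 _ _ (ratr a))// (near2 _ _ (ratr b)).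
Qed.

End borel_plane.

(** * Logarithmic energy of a measure carried by the circle *)

Section energy_circle.
Context {R : realType}.
Local Notation mu := (@lebesgue_measure R).
Local Notation RR := (measurableTypeR R).
Local Notation T := (borelC R).
Variable m : probability T R.
Hypothesis mcirc : m.-negligible (~` (@unit_circle R : set T)).

Lemma normc_circleB_le (z w : Cplx R) : unit_circle z -> unit_circle w ->
  Normc.normc (z - w) <= 2.
Proof.
move=> /unit_circleE z1 /unit_circleE w1.
by rewrite (le_trans (normcD_le _ _))// normcN z1 w1.
Qed.

(** Distances on the circle are at most 2, and [2 <= e]: this is what the [e] in the kernel is
    for. *)
Lemma log_kernel_ge0 (z w : Cplx R) : unit_circle z -> unit_circle w ->
  (0 <= log_kernel z w)%E.
Proof.
move=> cz cw; rewrite /log_kernel; case: eqVneq => // zw.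
have n0 : 0 < Normc.normc (z - w).
  rewrite lt_def normc_ge0 andbT; apply/eqP => /Normc.eq0_normc/eqP.
  by rewrite subr_eq0 (negbTE zw).
rewrite lee_fin ln_ge0// ler_pdivlMr// mul1r.
apply: (le_trans (normc_circleB_le cz cw)).
by apply: le_trans (expR_ge1Dx _); rewrite -[2]/(1 + 1).
Qed.

(** It coincides with the kernel on the circle and is nonnegative everywhere, so that Tonelli's
    theorem applies without restricting the variables. *)
Definition log_kernel_pos (z w : T) : \bar R := maxe (log_kernel z w) 0%E.

Lemma measurable_log_kernel_pos :
  measurable_fun setT (fun z : T * T => log_kernel_pos z.1 z.2).
Proof. exact: measurable_maxe measurable_log_kernel (measurable_cst _). Qed.

Lemma log_kernel_pos_ge0 z w : (0 <= log_kernel_pos z w)%E.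
Proof. by rewrite /log_kernel_pos le_max lexx orbT. Qed.

Lemma log_energyE : log_energy m = (\int[m]_z \int[m]_w log_kernel_pos z w)%E.
Proof.
have mk := @measurable_log_kernel R.
have mkp := measurable_log_kernel_pos.
have mkn : measurable_fun setT (fun z : T * T => maxe (- log_kernel z.1 z.2) 0)%E.
  apply: measurable_maxe; last exact: measurable_cst.
  exact: measurableT_comp.
have mz (f : T * T -> \bar R) z : measurable_fun setT f ->
    measurable_fun setT (fun w => f (z, w)).
  by move=> mf; exact: (measurableT_comp mf (pair1_measurable z)).
(* The inner integral of the signed kernel is by definition the difference of the integrals of its
   positive and negative parts, each measurable in [z] by Tonelli's theorem. *)
have mF : measurable_fun setT (fun z : T => \int[m]_w log_kernel z w)%E.
  have -> : (fun z : T => \int[m]_w log_kernel z w)%E = (fun z : T =>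
      \int[m]_w log_kernel_pos z w - \int[m]_w maxe (- log_kernel z w) 0)%E.
    apply/funext => z; rewrite [LHS]integralE.
    by congr (_ - _)%E; apply: eq_integral => w _; rewrite ?funeposE ?funenegE.
  apply: emeasurable_funB.
    by apply: (measurable_fun_fubini_tonelli_F _ mkp) => z; exact: log_kernel_pos_ge0.
  apply: (measurable_fun_fubini_tonelli_F _ mkn) => z.
  by rewrite le_max lexx orbT.
apply: ae_eq_integral => //.
  by apply: (measurable_fun_fubini_tonelli_F _ mkp) => z; exact: log_kernel_pos_ge0.
apply: negligibleS mcirc => z /= hz cz; apply: hz => _.
apply: ae_eq_integral => //.
- exact: (mz _ z mk).
- exact: (mz _ z mkp).
apply: negligibleS mcirc => w /= hw cw; apply: hw => _.
by rewrite /log_kernel_pos; apply/esym/max_idPl; exact: log_kernel_ge0.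
Qed.

(** With [Re] or [Im] for [u], a coordinate of [r z] on the circle. The value 0 elsewhere keeps the
    bounds on the coordinates valid at every point, not only almost everywhere. *)
Definition circle_coord (r : R) (u : Cplx R -> R) : T -> RR :=
  (fun z : T => r * u z) \_ (@unit_circle R).

Lemma measurable_circle_coord r (u : Cplx R -> R) :
  measurable_fun setT (u : T -> RR) -> measurable_fun setT (circle_coord r u).
Proof.
move=> mu'; apply/(measurable_restrictT _ measurable_unit_circle).
by apply: measurable_funTS; exact: measurable_funM.
Qed.

Lemma circle_coord_le1 r (u : Cplx R -> R) z : 0 <= r <= 1 ->
  (forall z, `|u z| <= Normc.normc z) -> `|circle_coord r u z| <= 1.
Proof.
move=> /andP[r0 r1] hu; rewrite /circle_coord patchE; case: ifPn => [|_]; last by rewrite normr0.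
move=> /set_mem/unit_circleE z1.
by rewrite normrM ger0_norm// mulr_ile1// -z1 hu.
Qed.

(** With [D] the distance after scaling and [N = |z - w|], the bounds [r >= 1/2] and [normc_le_max]
    give [N <= 4 * D], hence [3 / D <= 12 / N <= 12 * (e / N)]. On the diagonal the right-hand side
    is infinite. *)
Lemma log_bound_le_kernel r (z w : Cplx R) : 2^-1 <= r <= 1 ->
  unit_circle z -> unit_circle w ->
  (log_bound (maxdist (circle_coord r (@complex.Re R)) (circle_coord r (@complex.Im R)) z w)
    <= (ln 12)%:E + log_kernel_pos z w)%E.
Proof.
move=> /andP[r2 r1] cz cw.
have r0 : 0 < r by apply: lt_le_trans r2; rewrite invr_gt0.
have ln12 : (0 <= ln 12 :> R)%R by rewrite ln_ge0// ler1n.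
have kE : log_kernel_pos z w = log_kernel z w.
  by rewrite /log_kernel_pos; apply/max_idPl; exact: log_kernel_ge0.
rewrite kE /log_kernel; have [->|zw] := eqVneq z w; first by rewrite addey ?leey.
set D := maxdist _ _ _ _.
have DE : D = r * Num.max `|complex.Re (z - w)| `|complex.Im (z - w)|.
  rewrite /D /maxdist /circle_coord !patchE (mem_set cz) (mem_set cw).
  by rewrite -!mulrBr !normrM (ger0_norm (ltW r0)) -!raddfB maxr_pMr ?(ltW r0).
set N := Normc.normc (z - w).
have N0 : 0 < N.
  rewrite lt_def normc_ge0 andbT; apply/eqP => /Normc.eq0_normc/eqP.
  by rewrite subr_eq0 (negbTE zw).
have N2 : N <= 2 by exact: normc_circleB_le.
have NM := normc_le_max (z - w); rewrite -/N in NM.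
have MN : Num.max `|complex.Re (z - w)| `|complex.Im (z - w)| <= N.
  by rewrite ge_max Re_le_normc Im_le_normc.
set M := Num.max _ _ in DE NM MN.
have M0 : 0 <= M by rewrite le_max normr_ge0.
have ND : N <= 4 * D.
  rewrite DE; apply: (le_trans NM).
  have : 2^-1 * M <= r * M by rewrite ler_wpM2r.
  lra.
have D0 : 0 < D.
  by rewrite -(ltr_pM2l (_ : 0 < 4))// mulr0 (lt_le_trans N0).
have D3 : D < 3.
  rewrite DE; have : r * M <= 1 * N by rewrite ler_pM// ltW.
  lra.
apply: (le_trans (log_bound_le D0 D3)).
rewrite -EFinD lee_fin.
have e1 : (1 : R) <= expR 1.
  by apply: le_trans (expR_ge1Dx _); rewrite lerDl.
rewrite -lnM ?posrE ?divr_gt0 ?expR_gt0//.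
rewrite ler_ln ?posrE ?mulr_gt0 ?invr_gt0 ?expR_gt0//.
rewrite mulrA ler_pdivrMr// mulrAC ler_pdivlMr//.
have : 1 * (4 * D) <= expR 1 * (4 * D) by rewrite ler_wpM2r// mulr_ge0// ltW.
lra.
Qed.

Lemma integral_log_bound_le r : 2^-1 <= r <= 1 ->
  (\int[m]_z \int[m]_w
     log_bound (maxdist (circle_coord r (@complex.Re R)) (circle_coord r (@complex.Im R)) z w)
   <= (ln 12)%:E + log_energy m)%E.
Proof.
move=> hr; set a := circle_coord r _; set b := circle_coord r _.
have ma : measurable_fun setT a by exact: measurable_circle_coord measurable_Re.
have mb : measurable_fun setT b by exact: measurable_circle_coord measurable_Im.
have ln12 : (0 <= ln 12 :> R)%R by rewrite ln_ge0// ler1n.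
have mkp := measurable_log_kernel_pos.
have kp0 := log_kernel_pos_ge0.
have mD := measurable_maxdist ma mb.
have lb0 D : (0 <= log_bound D :> \bar R)%E.
  apply: integral_ge0 => s _; rewrite lee_fin; case: ifP => // /andP[s0 _].
  by rewrite invr_ge0 ltW.
have mlb : measurable_fun setT (fun z : T * T => log_bound (maxdist a b z.1 z.2)).
  have m3 : measurable_fun setT (fun z : (T * T) * RR =>
      (if [&& 0 < z.2, z.2 <= 1 & maxdist a b z.1.1 z.1.2 <= 3 * z.2] then z.2^-1 else 0)%:E).
    apply/measurable_EFinP; apply: measurable_fun_ifT => //; last exact: measurable_funV.
    apply: measurable_and; first exact: measurable_fun_ltr.
    apply: measurable_and; first exact: measurable_fun_ler.
    apply: measurable_fun_ler; last exact: measurable_funM.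
    exact: (measurableT_comp mD (@measurable_fst _ _ (T * T)%type RR)).
  apply: (measurable_fun_fubini_tonelli_F _ m3) => z.
  by rewrite lee_fin; case: ifP => // /andP[s0 _]; rewrite invr_ge0 ltW.
have mz (f : T * T -> \bar R) z : measurable_fun setT f ->
    measurable_fun setT (fun w => f (z, w)).
  by move=> mf; exact: (measurableT_comp mf (pair1_measurable z)).
have mkI : measurable_fun setT (fun z : T => \int[m]_w log_kernel_pos z w)%E.
  by apply: (measurable_fun_fubini_tonelli_F _ mkp) => z; exact: kp0.
have kI0 z : (0 <= \int[m]_w log_kernel_pos z w)%E by exact: integral_ge0.
have cst_int (c : R) : (\int[m]_z c%:E = c%:E)%E.
  by rewrite integral_cst// [X in (_ * X)%E]probability_setT mule1.
have -> : ((ln 12)%:E + log_energy m =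
    \int[m]_z ((ln 12)%:E + \int[m]_w log_kernel_pos z w))%E.
  by rewrite log_energyE -[X in (X + _)%E = _](cst_int (ln 12)) -ge0_integralD.
have lbI : measurable_fun setT (fun z : T => \int[m]_w log_bound (maxdist a b z w))%E.
  by apply: (measurable_fun_fubini_tonelli_F _ mlb) => z; exact: lb0.
apply: ae_ge0_le_integral => //.
- by move=> z _; exact: integral_ge0.
- by move=> z _; rewrite adde_ge0.
- exact: emeasurable_funD.
apply: negligibleS mcirc => z /= hz cz; apply: hz => _.
have -> : ((ln 12)%:E + \int[m]_w log_kernel_pos z w =
    \int[m]_w ((ln 12)%:E + log_kernel_pos z w))%E.
  rewrite -[X in (X + _)%E = _](cst_int (ln 12)) -ge0_integralD//.
  exact: (mz _ z mkp).
apply: ae_ge0_le_integral => //.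
- exact: (mz _ z mlb).
- by move=> w _; rewrite adde_ge0.
- by apply: emeasurable_funD => //; exact: (mz _ z mkp).
apply: negligibleS mcirc => w /= hw cw; apply: hw => _.
exact: log_bound_le_kernel.
Qed.

End energy_circle.

(** * Capacity of the contact sets *)

Section contact_set_energy.
Context {R : realType}.
Local Notation mu := (@lebesgue_measure R).
Local Notation RR := (measurableTypeR R).
Local Notation T := (borelC R).
Local Open Scope complex_scope.
Implicit Types (phi g : Cplx R -> Cplx R) (xi z : Cplx R).

(** On a compact square the continuous modulus of [phi] attains its maximum, which is below 1. *)
Lemma schur_half_square phi : schur phi -> exists2 rho : R, rho < 1 &
  forall y, half_square y -> Normc.normc (phi (cpoint y)) <= rho.
Proof.
move=> [aphi Dphi].
pose Q : set (R * R) := `[- 2^-1, 2^-1]%classic `*` `[- 2^-1, 2^-1]%classic.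
have Q0 : Q !=set0.
  by exists (0, 0); split; rewrite /= in_itv/= oppr_le0 invr_ge0 ler0n.
have cQ : compact Q by apply: compact_setX; exact: segment_compact.
pose h (p : R * R) : R := Normc.normc (phi (cpoint p)).
have ch : {within Q, continuous h}.
  apply: continuous_in_subspaceT => p /set_mem Qp.
  have Dp : plane_disk p.
    by apply: half_square_disk; rewrite half_squareE.
  apply/cvgrPdist_lt => e e0.
  have [d d0 hd] := derivable_continuousP (aphi _ Dp) e0.
  have d20 : 0 < d / 2 by rewrite divr_gt0.
  exists (ball p.1 (d / 2), ball p.2 (d / 2)).
    by split; exact: nbhsx_ballx.
  move=> q [/= q1 q2].
  rewrite distrC; apply: le_lt_trans (normcB_ge _ _) _; apply: hd.
  rewrite [ltRHS](_ : d = 2 * (d / 2)); last by field.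
  by apply: normc_cpointB; rewrite distrC.
have [c /set_mem Qc hc] := compact_EVT_max Q0 cQ ch.
exists (h c).
  apply/unit_diskE; apply: Dphi.
  by apply: half_square_disk; rewrite half_squareE.
by move=> y; rewrite half_squareE => Qy; apply: hc; rewrite inE.
Qed.

Lemma radial_limit_normc phi z xi : radial_limit phi z xi -> forall e : R, 0 < e ->
  exists2 d : R, 0 < d & forall r : R, 1 - d < r -> r < 1 ->
    Normc.normc (phi (r%:C * z) - xi) < e.
Proof.
move=> hphi e e0.
have /hphi : nbhs xi [set w | Normc.normc (w - xi) < e].
  by apply/nbhs_normcP; exists e.
rewrite /nbhs/= => /nbhs_ballP[d /= d0 hd]; exists d => // r dr r1.
apply: (hd r) => //; rewrite /ball/= ger0_norm ?subr_ge0 ?(ltW r1)//.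
by rewrite ltrBlDr addrC -ltrBlDr.
Qed.

(** Starting at [k.+2] keeps the radii at least one half, as the comparison with the logarithmic
    kernel demands. *)
Definition radius (k : nat) : R := 1 - k.+2%:R^-1.

Lemma radius_bounds k : 2^-1 <= radius k /\ radius k < 1.
Proof.
have h : (k.+2%:R^-1 : R) <= 2^-1 by rewrite lef_pV2 ?posrE ?ltr0n// ler_nat.
have h0 : 0 < (k.+2%:R^-1 : R) by rewrite invr_gt0 ltr0n.
by rewrite /radius; move: (k.+2%:R^-1 : R) h h0 => x h h0; split; lra.
Qed.

Lemma radius01 k : 0 <= radius k <= 1.
Proof.
by have [h1 h2] := radius_bounds k; rewrite (ltW h2) andbT (le_trans _ h1).
Qed.

Variable m : probability T R.
Variables (phi : Cplx R -> Cplx R) (xi : Cplx R).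
Hypotheses (hphi : schur phi) (hxi : unit_circle xi).
Hypothesis hm : m.-negligible (~` (contact_set phi xi : set T)).

Let mcirc : m.-negligible (~` (@unit_circle R : set T)).
Proof. by apply: negligibleS hm => z /= hz [cz _]; exact: hz. Qed.

Let a (k : nat) := circle_coord (radius k) (@complex.Re R).
Let b (k : nat) := circle_coord (radius k) (@complex.Im R).

Let abE k z : unit_circle z -> cpoint (a k z, b k z) = (radius k)%:C * z.
Proof.
move=> cz; rewrite /a /b /circle_coord !patchE (mem_set cz) /cpoint/=.
by case: z {cz} => x y; simpc.
Qed.

Let ab_disk k z : plane_disk (a k z, b k z).
Proof.
apply/unit_diskE; have [cz|cz] := pselect (unit_circle z).
  rewrite (abE k cz) Normc.normcM normc_real (unit_circleE z).1// mulr1.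
  by have [_] := radius_bounds k; rewrite ger0_norm//; have /andP[] := radius01 k.
rewrite /a /b /circle_coord !patchE !memNset// /cpoint/=.
by rewrite expr0n/= addr0 sqrtr0.
Qed.

(** The potential bound at [radius k] times [t] is integrated against [m], uniformly in [k], and [k]
    tends to infinity by dominated convergence. On the contact set the real part of [g] tends to the
    value of the test polynomial at [xi], which is the harmonic sum. *)
Lemma harmonic_sum_le_energy (n : nat) (M tau rho : R) : 0 < tau -> rho < 1 ->
  (forall y, half_square y -> Normc.normc (phi (cpoint y)) <= rho) ->
  let f : Cplx R -> Cplx R := horner (log_poly xi (2 ^ n)) in
  analytic_on_disk (f \o phi) ->
  (gradient_energy (f \o phi) <= M%:E)%E ->
  (log_energy m < +oo)%E ->
  harmonic_sum (2 ^ n) <= (1 - rho)^-1 + tau^-1 * M +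
    tau * (2 * (ln 12 + fine (log_energy m))).
Proof.
move=> tau0 rho1 hrho f ag gM Efin.
set g := f \o phi.
have xi1 : Normc.normc xi = 1 by exact/unit_circleE.
set H := harmonic_sum (2 ^ n).
have H0 : 0 <= H by rewrite /H /harmonic_sum sumr_ge0.
have ma k : measurable_fun setT (a k) by exact: measurable_circle_coord measurable_Re.
have mb k : measurable_fun setT (b k) by exact: measurable_circle_coord measurable_Im.
have a1 k t : `|a k t| <= 1.
  by apply: circle_coord_le1; [exact: radius01|exact: Re_le_normc].
have b1 k t : `|b k t| <= 1.
  by apply: circle_coord_le1; [exact: radius01|exact: Im_le_normc].
have E0 : (0 <= log_energy m)%E.
  rewrite (log_energyE mcirc); apply: integral_ge0 => z _.
  by apply: integral_ge0 => w _; exact: log_kernel_pos_ge0.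
have EE : log_energy m = (fine (log_energy m))%:E by rewrite fineK// ge0_fin_numE.
set I := fine (log_energy m) in EE *.
pose U : RR * RR -> RR := (fun p => complex.Re (g (cpoint p))) \_ plane_disk.
have gH p : plane_disk p -> `|complex.Re (g (cpoint p))| <= H.
  move=> Dp; apply: le_trans (Re_le_normc _) _.
  apply: log_poly_le_harmonic => //; apply: ltW; apply/unit_diskE.
  by case: hphi => _; exact.
have mU : measurable_fun setT U.
  apply/(measurable_restrictT _ measurable_plane_disk).
  apply: (@measurable_fun_disk _ (fun z => complex.Re (g z))) => z e Dz e0.
  have [d d0 hd] := derivable_continuousP (ag _ Dz) e0; exists d => // w /hd.
  apply: le_lt_trans; rewrite -raddfB; exact: Re_le_normc.
(* Adding [H] makes the integrands nonnegative; they lie between 0 and [H + H], and one copy of [H]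
   cancels at the end. *)
pose F (k : nat) (t : T) : \bar R := (H + U (a k t, b k t))%:E.
have UE k t : U (a k t, b k t) = complex.Re (g (cpoint (a k t, b k t))).
  by rewrite /U patchE mem_set//; exact: ab_disk.
have mF k : measurable_fun setT (F k).
  apply/measurable_EFinP; apply: measurable_funD => //.
  by apply: (measurableT_comp mU); exact: measurable_fun_pair.
have F0 k t : (0 <= F k t)%E.
  rewrite lee_fin UE; have := gH _ (ab_disk k t); rewrite ler_norml => /andP[h _].
  by rewrite -lerBlDl sub0r.
have F2 k t : (F k t <= (H + H)%:E)%E.
  rewrite lee_fin UE lerD2l; have := gH _ (ab_disk k t).
  by rewrite ler_norml => /andP[].
set rho' := (1 - rho)^-1.
have rho'0 : 0 <= rho' by rewrite invr_ge0 subr_ge0 ltW.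
have G0 := disk_gradient_ge0 g.
have mG := measurable_disk_gradient ag.
have Fle k t : (F k t <= (H + rho')%:E +
    2%:E * cone_potential (a k) (b k) (disk_gradient g) t)%E.
  rewrite /F UE (EFinD H (complex.Re _)) (EFinD H rho') -addeA; apply: leeD2l.
  apply: (Re_le_cone_potential (ma k) (mb k) ag (ab_disk k t)) => y Sy;
    apply: le_trans (ler_norm _) _; apply: le_trans (Re_le_normc _) _.
  exact: (log_poly_bound _ xi1 (hrho y Sy) rho1).
have ln12 : (0 <= ln 12 :> R)%R by rewrite ln_ge0// ler1n.
have Vle k : (\int[m]_t (2%:E * cone_potential (a k) (b k) (disk_gradient g) t) <=
    (tau^-1 * M + tau * (2 * (ln 12 + I)))%:E)%E.
  apply: (le_trans (integral_cone_potential_le m (ma k) (mb k) tau0 mG G0)).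
  rewrite EFinD; apply: leeD.
    rewrite EFinM; apply: lee_wpmul2l => //.
    by rewrite lee_fin invr_ge0 ltW.
  rewrite EFinM; apply: lee_wpmul2l; first by rewrite lee_fin ltW.
  apply: (le_trans (integral_cone_weight_square m (ma k) (mb k) (a1 k) (b1 k))).
  rewrite EFinM; apply: lee_wpmul2l => //.
  rewrite EFinD -EE; apply: (integral_log_bound_le mcirc).
  by have [h1 /ltW h2] := radius_bounds k; rewrite h1.
have cst_int (c : R) : (\int[m]_z c%:E = c%:E)%E.
  by rewrite integral_cst// [X in (_ * X)%E]probability_setT mule1.
have cp0 k t : (0 <= 2%:E * cone_potential (a k) (b k) (disk_gradient g) t)%E.
  rewrite mule_ge0//; apply: integral_ge0 => p _; rewrite mule_ge0 ?lee_fin//.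
  by apply: integral_ge0 => s _; rewrite lee_fin cone_weight_ge0.
pose C : R := H + rho' + (tau^-1 * M + tau * (2 * (ln 12 + I))).
have mcp k : measurable_fun setT
    (fun t => 2%:E * cone_potential (a k) (b k) (disk_gradient g) t)%E.
  by apply: measurable_funeM; exact: (measurable_cone_potential (ma k) (mb k)).
have intF k : (\int[m]_t F k t <= C%:E)%E.
  have Hr0 : (0 <= (H + rho')%:E :> \bar R)%E by rewrite lee_fin addr_ge0.
  apply: (@le_trans _ _ (\int[m]_t ((H + rho')%:E +
      2%:E * cone_potential (a k) (b k) (disk_gradient g) t))%E).
    apply: ge0_le_integral => //.
    exact: emeasurable_funD.
  rewrite ge0_integralD// /C [leRHS]EFinD; apply: leeD => //.
  by rewrite [leLHS](cst_int (H + rho')).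
have Flim : {ae m, forall t, setT t -> F k t @[k --> \oo] --> (H + H)%:E}.
  apply: negligibleS hm => t /= ht ct; apply: ht => _.
  have [cirt limt] := ct.
  suff h : (H + U (a k t, b k t)) @[k --> \oo] --> H + H.
    by apply: cvg_EFin => //; exact: nearW.
  apply/cvgrPdist_lt => e e0.
  have [d d0 hd] := derivable_continuousP (@derivable_log_poly R xi (2 ^ n) xi) e0.
  have [d' d'0 hd'] := radial_limit_normc limt d0.
  have [N _ hN] := near_infty_natSinv_lt (PosNum d'0).
  exists N => // k /= Nk.
  have kd : k.+2%:R^-1 < d' by exact: (hN k.+1 (leqW Nk)).
  rewrite opprD addrACA subrr add0r UE (abE k cirt).
  have [_ rk1] := radius_bounds k.
  have /hd : Normc.normc (phi ((radius k)%:C * t) - xi) < d.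
    by apply: hd' => //; rewrite /radius ltrD2l ltrN2.
  rewrite (log_poly_at _ xi1); apply: le_lt_trans.
  rewrite distrC -[X in _ - X]/(complex.Re (H%:C : Cplx R)) -raddfB.
  exact: Re_le_normc.
have intH : m.-integrable setT (fun=> (H + H)%:E).
  exact: finite_measure_integrable_cst.
have Fdom : {ae m, forall t (k : nat), setT t -> (`|F k t| <= (H + H)%:E)%E}.
  by apply: aeW => t k _; rewrite gee0_abs.
have [_ _] := dominated_convergence measurableT mF (measurable_cst _) Flim intH Fdom.
rewrite [X in _ --> X](cst_int (H + H)) => hlim.
have : ((H + H)%:E <= C%:E)%E.
  rewrite -(cvg_lim _ hlim)//; apply: lime_le; first by apply/cvg_ex; eexists; exact: hlim.
  by apply: nearW => k; exact: intF.
by rewrite lee_fin /C -addrA lerD2l addrA.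
Qed.

End contact_set_energy.

Theorem theorem2p1 (R : realType) (phi : Cplx R -> Cplx R)
    (hphi : schur phi)
    (hbdd : bounded_on_dirichlet (composition_operator phi))
    (xi : Cplx R) (hxi : unit_circle xi) :
  log_capacity (contact_set phi xi) = 0%E.
Proof.
(* If every admissible measure has infinite energy, each [expeR (- log_energy m)] is 0 and the
   supremum is that of the set reduced to 0. *)
suff energy_oo (m : probability (borelC R) R) :
    measure_support m `<=` contact_set phi xi -> log_energy m = +oo%E.
  rewrite /log_capacity (_ : _ `|` _ = [set 0%E]) ?ereal_sup1//.
  apply/seteqP; split=> [x [//|[m [_ hm] <-]]|x ->]; last by left.
  by rewrite energy_oo.
move=> supp; apply/eqP; rewrite -leye_eq leNgt; apply/negP => Efin.
have hm : m.-negligible (~` (contact_set phi xi : set (borelC R))).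
  apply: negligibleS (support_complement_negligible m).
  by apply: subsetC; exact: supp.
have xi1 : Normc.normc xi = 1 by exact/unit_circleE.
have [rho rho1 hrho] := schur_half_square hphi.
have [hmap [M hM]] := hbdd.
set c0 := (1 - rho)^-1; set c1 := M ^+ 2 * 64.
set c2 := 2 * (ln 12 + fine (log_energy m)).
(* The choices [n.+1 = k.+1 ^ 2] and [tau = k.+1] balance the two terms in [tau]: both become linear
   in [k.+1], while the harmonic sum is at least [n%:R / 2], quadratic in [k.+1]. *)
have bound (k : nat) : (k.+1%:R ^+ 2 - 1) / 2 <= c0 + k.+1%:R * (c1 + c2) :> R.
  pose n := (k.+1 ^ 2).-1.
  have nE : n.+1 = (k.+1 ^ 2)%N by rewrite /n prednK// expn_gt0.
  have Df := log_poly_dirichlet n xi1; have Dg := hmap _ Df.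
  have Eg := gradient_energy_composition Df Dg (hM _ Df).
  have Ef := gradient_energy_log_poly n xi1.
  have [ag _ _] := Dg.
  have Mg : (gradient_energy ((horner (log_poly xi (2 ^ n)) : Cplx R -> Cplx R) \o phi) <=
      (M ^+ 2 * (64 * n.+1%:R))%:E)%E.
    apply: (le_trans Eg); rewrite [leRHS]EFinM; apply: lee_wpmul2l => //.
    by rewrite lee_fin sqr_ge0.
  have k0 : 0 < k.+1%:R :> R by [].
  have := harmonic_sum_le_energy hphi hxi hm k0 rho1 hrho ag Mg Efin.
  rewrite -/c0 -/c2 => hH.
  have := le_trans (harmonic_sum_ge n) hH.
  have -> : n%:R = k.+1%:R ^+ 2 - 1 :> R.
    by rewrite -natrX -nE -natr1 addrK.
  have -> : k.+1%:R^-1 * (M ^+ 2 * (64 * n.+1%:R)) = k.+1%:R * c1.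
    by rewrite nE natrX /c1; field; rewrite gt_eqF.
  by rewrite mulrDr addrA.
(* With [x = k.+1] at least 1, the bound gives [x^2 <= 2 A x + 1], which fails as soon as
   [x > 2 A + 1]. *)
pose A := `|c0| + `|c1 + c2|.
have A0 : 0 <= A by rewrite addr_ge0.
set k := Num.truncn (2 * A + 1).
have xA : 2 * A + 1 < k.+1%:R by exact: truncnS_gt.
have x1 : 1 <= k.+1%:R :> R by rewrite ler1n.
have := bound k; move: (k.+1%:R : R) xA x1 => x xA x1 hx.
have h1 : c0 <= x * `|c0|.
  by apply: le_trans (ler_norm _) _; rewrite ler_peMl.
have h2 : x * (c1 + c2) <= x * `|c1 + c2|.
  by rewrite ler_wpM2l ?ler_norm// (le_trans ler01).
have h3 : x * (2 * A + 1) < x * x by rewrite ltr_pM2l// (lt_le_trans ltr01).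
have h4 : x * A = x * `|c0| + x * `|c1 + c2| by rewrite -mulrDr.
move: hx; rewrite expr2; lra.
Qed.
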